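(* Put $\mathcal P=\mathcal V[\mu]$, $\mathcal A=\mathsf V(R_{11})$ and $B=\{\varepsilon,\gamma_1^D,\gamma_1,\kappa,\mu_2,\mu_D,\mu\}$. The interval $[\mathcal P,\mathcal V]$ of $\operatorname{Sub}(\mathcal V)$ consists of exactly the following sixteen nodes, with twenty-five cover edges. For each node we list a relative basis $E$ (the node is $\mathcal V[E]$), its truth vector in the coordinate order $(\varepsilon,\gamma_1^D,\gamma_1,\kappa,\mu_2,\mu_D,\mu)$, and its lower covers in the interval: P00: $\varnothing$; 0000000; P01. P01: $\{\varepsilon\}$; 1000000; P02, P03, P04. P02: $\{\gamma_1^D\}$; 1100000; P05, P06, P07. P03: $\{\kappa\}$; 1001000; P06, P08. P04: $\{\mu_2\}$; 1000100; P07, P08. P05: $\{\gamma_1\}$; 1110000; P09, P10. P06: $\{\gamma_1^D,\kappa\}$; 1101000; P09, P11. P07: $\{\gamma_1^D,\mu_2\}$; 1100100; P10, P11. P08: $\{\kappa,\mu_2\}$; 1001100; P11. P09: $\{\gamma_1,\kappa\}$; 1111000; P12. P10: $\{\gamma_1,\mu_2\}$; 1110100; P12. P11: $\{\gamma_1^D,\kappa,\mu_2\}$; 1101100; P12, P13. P12: $\{\gamma_1,\kappa,\mu_2\}$; 1111100; P14. P13: $\{\mu_D\}$; 1101110; P14. P14: $\{\gamma_1,\mu_D\}$; 1111110; P15. P15: $\{\mu\}$; 1111111; none. The rules $$\gamma_1^D\Rightarrow\varepsilon,\quad \gamma_1\Rightarrow\gamma_1^D,\quad \kappa\Rightarrow\varepsilon,\quad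 \mu_2\Rightarrow\varepsilon,\quad \mu_D\Rightarrow\gamma_1^D,\kappa,\mu_2,\quad \mu\Rightarrow\gamma_1,\mu_D$$ are complete for implications relative to $\mathcal V$ among elements of $B$, including implications with multiple premises: for $E\subseteq B$ and $f\in B$, $\mathcal V[E]\models f$ iff $f$ lies in the closure of $E$ under these rules. The interval is distributive, and $$\mathcal V[\gamma_1,\mu_D]\succ\mathcal P,\qquad \mathcal V[\gamma_1,\mu_D]=\mathcal P\vee\mathsf V(R_{01}),$$ where $\succ$ means ''covers''. The node $\mathcal V[\gamma_1,\mu_D]$ is the unique upper cover of $\mathcal P$. Exactly seven nodes in the interval contain $\mathcal A$; the remaining nine are incomparable with $\mathcal A$.
   Context: Language: two binary operations $+,\cdot$, no constants. $u\preceq v$ abbreviates $u+v\approx v$. $\mathsf V(S)$ is the variety generated by $S$. Let $M=\{0,c,p,q,a,b\}$ (letters used as elements only in this paragraph) be the commutative semigroup whose only nonzero products are $pb=bp=ab=ba=aq=qa=c$. For $i,j\in\{0,1,2\}$, $R_{ij}$ is the commutative additively idempotent semiring on $M$ with this multiplication whose addition is the join operation of the partial order generated by $a<p<0$, $b<q<0$, $c<0$, together with: the first $i$ elements of the chain $a<p$ lie below $c$, and the first $j$ elements of the chain $b<q$ lie below $c$. $\mathcal V=\mathsf V(R_{12})$; $\operatorname{Sub}(\mathcal V)$ is its lattice of subvarieties; $\mathcal V[E]$ is the subvariety of $\mathcal V$ defined by adjoining the identities in $E$. With $D(t,u)=t+u+tu$ and $L(a,b,c,d)=ab+bc+cd$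 (all letters variables): $\varepsilon: ad\preceq a+b+c+L(a,b,c,d)$; $\kappa: ad\preceq a+b+L(a,b,c,d)$; $\mu_2: ad\preceq b+c+L(a,b,c,d)$; $\mu: ad\preceq b+L(a,b,c,d)$; $\mu_D: ad\preceq b+L(a,b,c,d)+D(t,u)$; $\gamma_1: x_0y\preceq x_0+x_2+x_0x_1+x_1x_2+x_2y$; $\gamma_1^D: x_0y\preceq x_0+x_2+x_0x_1+x_1x_2+x_2y+D(t,u)$. The truth vector of a node records which of the seven identities hold in it (1 = holds). *)

(* Defs.v *)
From HB Require Import structures.
From mathcomp Require Import all_boot.
From mathcomp Require Import boolp classical_sets.

Set Implicit Arguments.
Unset Strict Implicit.
Unset Printing Implicit Defensive.

Local Open Scope classical_set_scope.

Record algebra := Algebra {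
  carrier :> Type;
  opA : carrier -> carrier -> carrier;
  opM : carrier -> carrier -> carrier;
  nonempty : inhabited carrier }.

Definition hom (A B : algebra) (f : A -> B) : Prop :=
  (forall x y, f (opA x y) = opA (f x) (f y)) /\
  (forall x y, f (opM x y) = opM (f x) (f y)).

Definition prod_alg (I : Type) (A : I -> algebra) : algebra :=
  @Algebra (forall i, A i)
    (fun x y i => opA (x i) (y i)) (fun x y i => opM (x i) (y i))
    (inhabits (fun i => inhabited_witness (nonempty (A i)))).

(* Closure under homomorphic images, isomorphic copies of subalgebras, and
   arbitrary (possibly empty) direct products. *)
Definition is_variety (K : set algebra) : Prop :=
  [/\ forall (A B : algebra) (f : A -> B),
        K A -> hom f -> (forall y, exists x, f x = y) -> K B,
      forall (A B : algebra) (f : A -> B),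
        K B -> hom f -> injective f -> K A
    & forall (I : Type) (A : I -> algebra),
        (forall i, K (A i)) -> K (prod_alg A)].

Definition generated (G : set algebra) : set algebra := smallest is_variety G.

Definition VV (A : algebra) : set algebra := generated [set A].

Definition vjoin (X Y : set algebra) : set algebra := generated (X `|` Y).

Definition subvarieties (V : set algebra) : set (set algebra) :=
  [set W | is_variety W /\ W `<=` V].

Definition vinterval (P V : set algebra) : set (set algebra) :=
  [set W | is_variety W /\ P `<=` W /\ W `<=` V].

(* [Y] is a lower cover of [X] within the collection [S], ordered by
   inclusion. *)
Definition covers (S : set (set algebra)) (X Y : set algebra) : Prop :=
  [/\ S X, S Y, Y `<` X &
      forall Z, S Z -> Y `<=` Z -> Z `<=` X -> Z = Y \/ Z = X].

Definition incomparable (X Y : set algebra) : Prop :=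
  ~ X `<=` Y /\ ~ Y `<=` X.

(* Intersection is the meet of two subvarieties. *)
Definition distributive_lattice (S : set (set algebra)) : Prop :=
  forall X Y Z, S X -> S Y -> S Z ->
    X `&` vjoin Y Z = vjoin (X `&` Y) (X `&` Z).

Inductive term := Var of nat | Add of term & term | Mul of term & term.

Declare Scope tm_scope.
Delimit Scope tm_scope with tm.
Bind Scope tm_scope with term.
Notation "s + t" := (Add s t) : tm_scope.
Notation "s * t" := (Mul s t) : tm_scope.

Fixpoint eval (A : algebra) (v : nat -> A) (t : term) : A :=
  match t with
  | Var n => v n
  | Add s t => opA (eval v s) (eval v t)
  | Mul s t => opM (eval v s) (eval v t)
  end.

Definition identity := (term * term)%type.

Definition sat (A : algebra) (e : identity) : Prop :=
  forall v : nat -> A, eval v e.1 = eval v e.2.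

Definition models (K : set algebra) (e : identity) : Prop :=
  forall A, K A -> sat A e.

Definition adjoin (K : set algebra) (E : set identity) : set algebra :=
  [set A | K A /\ forall e, E e -> sat A e].

Definition preceq (s t : term) : identity := ((s + t)%tm, t).

Inductive M := m0 | mc | mp | mq | ma | mb.

Definition M_to_ord (x : M) : 'I_6 :=
  inord match x with m0 => 0 | mc => 1 | mp => 2 | mq => 3 | ma => 4 | mb => 5 end.
Definition M_of_ord (n : 'I_6) : M := nth m0 [:: m0; mc; mp; mq; ma; mb] n.
Lemma M_to_ordK : cancel M_to_ord M_of_ord.
Proof. by case; rewrite /M_of_ord /M_to_ord inordK. Qed.
HB.instance Definition _ := Finite.copy M (can_type M_to_ordK).

Definition mulM (x y : M) : M :=
  match x, y with
  | mp, mb | mb, mp | ma, mb | mb, ma | ma, mq | mq, ma => mc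
  | _, _ => m0
  end.

(* Strict comparabilities generating the order of R_ij; only [i, j <= 2] are
   used. *)
Definition genM (i j : nat) : rel M := fun x y =>
  match x, y with
  | ma, mp | mp, m0 | mb, mq | mq, m0 | mc, m0 => true
  | ma, mc => 0 < i
  | mp, mc => 1 < i
  | mb, mc => 0 < j
  | mq, mc => 1 < j
  | _, _ => false
  end.

Definition leM (i j : nat) : rel M := connect (genM i j).

Definition is_join (i j : nat) (x y z : M) : bool :=
  [&& leM i j x z, leM i j y z
    & [forall w, leM i j x w && leM i j y w ==> leM i j z w]].

(* The default is never used: see [addM_join] and [is_join_uniq]. *)
Definition addM (i j : nat) (x y : M) : M :=
  odflt m0 [pick z | is_join i j x y z].

Definition Rsr (i j : nat) : algebra :=
  @Algebra M (addM i j) mulM (inhabits m0).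

Lemma leM_explicit i j x y :
  leM i j x y =
  match x, y with
  | _, m0 => true
  | ma, ma | ma, mp | mp, mp | mb, mb | mb, mq | mq, mq | mc, mc => true
  | ma, mc => (0 < i)
  | mp, mc => (1 < i)
  | mb, mc => (0 < j)
  | mq, mc => (1 < j)
  | _, _ => false
  end.
Proof.
set e := fun x y : M => match x, y with
  | _, m0 => true
  | ma, ma | ma, mp | mp, mp | mb, mb | mb, mq | mq, mq | mc, mc => true
  | ma, mc => (0 < i)
  | mp, mc => (1 < i)
  | mb, mc => (0 < j)
  | mq, mc => (1 < j)
  | _, _ => false
  end.
rewrite -[RHS]/(e x y); apply/idP/idP.
- case/connectP=> p; elim: p x => [|z p IH] x /=.
    by move=> _ ->; case: x.
  case/andP=> gxz /IH {}IH /IH; move: gxz.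
  by case: x; case: z {IH}; case: y; rewrite //=; case: i {e} => [|[]]; case: j => [|[]].
- have G u v : genM i j u v -> leM i j u v by exact: connect1.
  have T u v w : leM i j u v -> leM i j v w -> leM i j u w by exact: connect_trans.
  case: x; case: y; rewrite /e //= => H; try exact: connect0; try exact: G.
    by apply: (T _ mp); apply: G.
  by apply: (T _ mq); apply: G.
Qed.

Lemma forallME (P : pred M) :
  [forall w, P w] = [&& P m0, P mc, P mp, P mq, P ma & P mb].
Proof.
apply/forallP/idP => [H|]; first by rewrite !H.
by case/and5P=> ? ? ? ? /andP[? ?]; case.
Qed.

Lemma is_join_uniq i j x y z z' :
  is_join i j x y z -> is_join i j x y z' -> z = z'.
Proof.
move=> /and3P[xz yz /forallP/(_ z')/implyP zz'].
move=> /and3P[xz' yz' /forallP/(_ z)/implyP z'z].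
have {}zz' : leM i j z z' by apply: zz'; rewrite xz' yz'.
have {}z'z : leM i j z' z by apply: z'z; rewrite xz yz.
by move: zz' z'z; rewrite !leM_explicit; case: z {xz yz}; case: z' {xz' yz'}.
Qed.

Lemma addM_join i j x y : is_join i j x y (addM i j x y).
Proof.
rewrite /addM; case: pickP => [//|/= none]; exfalso.
move: (none m0) (none mc) (none mp) (none mq) (none ma) (none mb).
rewrite /is_join !forallME !leM_explicit.
by case: x {none}; case: y; case: i => [|[|?]]; case: j => [|[|?]].
Qed.

(* The labels of the elements of B, in the coordinate order of the truth
   vectors. *)
Inductive label := eps | gamma1D | gamma1 | kappa | mu2 | muD | mu.

Definition labels : seq label := [:: eps; gamma1D; gamma1; kappa; mu2; muD; mu].

Definition label_to_nat (l : label) : nat :=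
  match l with
  | eps => 0 | gamma1D => 1 | gamma1 => 2 | kappa => 3 | mu2 => 4 | muD => 5
  | mu => 6
  end.
Lemma label_to_natK : cancel label_to_nat (nth eps labels).
Proof. by case. Qed.
HB.instance Definition _ := Equality.copy label (can_type label_to_natK).

Section Identities.
Local Open Scope tm_scope.

(* [a, b, c, d] double as [x_0, x_1, x_2, y] in the identities gamma. *)
Let a := Var 0.
Let b := Var 1.
Let c := Var 2.
Let d := Var 3.
Let t := Var 4.
Let u := Var 5.
Let x0 := a.
Let x1 := b.
Let x2 := c.
Let y := d.
Let D := t + u + t * u.
Let L := a * b + b * c + c * d.

Definition ident (l : label) : identity :=
  match l with
  | eps => preceq (a * d) (a + b + c + L)
  | gamma1D => preceq (x0 * y) (x0 + x2 + x0 * x1 + x1 * x2 + x2 * y + D)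
  | gamma1 => preceq (x0 * y) (x0 + x2 + x0 * x1 + x1 * x2 + x2 * y)
  | kappa => preceq (a * d) (a + b + L)
  | mu2 => preceq (a * d) (b + c + L)
  | muD => preceq (a * d) (b + L + D)
  | mu => preceq (a * d) (b + L)
  end.

End Identities.

Inductive rule : label -> label -> Prop :=
  | rule_gamma1D_eps : rule gamma1D eps
  | rule_gamma1_gamma1D : rule gamma1 gamma1D
  | rule_kappa_eps : rule kappa eps
  | rule_mu2_eps : rule mu2 eps
  | rule_muD_gamma1D : rule muD gamma1D
  | rule_muD_kappa : rule muD kappa
  | rule_muD_mu2 : rule muD mu2
  | rule_mu_gamma1 : rule mu gamma1
  | rule_mu_muD : rule mu muD.

Inductive rule_closure (E : set label) : label -> Prop :=
  | closure_mem f of E f : rule_closure E f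
  | closure_rule e f of rule_closure E e & rule e f : rule_closure E f.

Definition calV : set algebra := VV (Rsr 1 2).

Definition Vsub (E : set label) : set algebra := adjoin calV (ident @` E).

Definition calP : set algebra := Vsub [set mu].

Definition calA : set algebra := VV (Rsr 1 1).

(* Relative basis, truth vector, indices of the lower covers. *)
Definition node_table : seq (seq label * seq nat * seq nat) := [::
  (* P00 *) ([::],                    [:: 0; 0; 0; 0; 0; 0; 0], [:: 1]);
  (* P01 *) ([:: eps],                [:: 1; 0; 0; 0; 0; 0; 0], [:: 2; 3; 4]);
  (* P02 *) ([:: gamma1D],            [:: 1; 1; 0; 0; 0; 0; 0], [:: 5; 6; 7]);
  (* P03 *) ([:: kappa],              [:: 1; 0; 0; 1; 0; 0; 0], [:: 6; 8]);
  (* P04 *) ([:: mu2],                [:: 1; 0; 0; 0; 1; 0; 0], [:: 7; 8]);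
  (* P05 *) ([:: gamma1],             [:: 1; 1; 1; 0; 0; 0; 0], [:: 9; 10]);
  (* P06 *) ([:: gamma1D; kappa],     [:: 1; 1; 0; 1; 0; 0; 0], [:: 9; 11]);
  (* P07 *) ([:: gamma1D; mu2],       [:: 1; 1; 0; 0; 1; 0; 0], [:: 10; 11]);
  (* P08 *) ([:: kappa; mu2],         [:: 1; 0; 0; 1; 1; 0; 0], [:: 11]);
  (* P09 *) ([:: gamma1; kappa],      [:: 1; 1; 1; 1; 0; 0; 0], [:: 12]);
  (* P10 *) ([:: gamma1; mu2],        [:: 1; 1; 1; 0; 1; 0; 0], [:: 12]);
  (* P11 *) ([:: gamma1D; kappa; mu2], [:: 1; 1; 0; 1; 1; 0; 0], [:: 12; 13]);
  (* P12 *) ([:: gamma1; kappa; mu2], [:: 1; 1; 1; 1; 1; 0; 0], [:: 14]);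
  (* P13 *) ([:: muD],                [:: 1; 1; 0; 1; 1; 1; 0], [:: 14]);
  (* P14 *) ([:: gamma1; muD],        [:: 1; 1; 1; 1; 1; 1; 0], [:: 15]);
  (* P15 *) ([:: mu],                 [:: 1; 1; 1; 1; 1; 1; 1], [::])
].

Definition node_entry (k : 'I_16) := nth ([::], [::], [::]) node_table k.
Definition node_basis (k : 'I_16) : seq label := (node_entry k).1.1.
Definition node_truth (k : 'I_16) : seq nat := (node_entry k).1.2.
Definition node_lower (k : 'I_16) : seq nat := (node_entry k).2.

Definition node (k : 'I_16) : set algebra :=
  Vsub [set` node_basis k].

Definition truth_vector (W : set algebra) : seq nat :=
  [seq nat_of_bool `[< models W (ident l) >] | l <- labels].

(* Main.v *)
Require Import Defs.
From mathcomp Require Import all_boot.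
From mathcomp Require Import boolp classical_sets.

(* In [Rsr i j] squares and products of three elements vanish, so a term that is
   not constantly [m0] is a graph (products of two variables are edges) with
   some marked vertices (variables occurring linearly). If it has an edge, its
   nonzero valuations are the homomorphisms to the path mp - mb - ma - mq that
   send marked vertices below [mc]. Hence in the variety a term with a
   nonbipartite graph is the top element, and for a bipartite [t] the only
   inequalities [xy <= t] besides the edges are those with [x] and [y] marked
   and joined by an odd walk.

   Let [xy <= t] hold in calP but not in the variety. Testing it on one algebra
   of calP shows that an odd walk joins x and y and that their component has a
   marked vertex. If only one side of the component is marked, the inequality is
   equivalent to one of gamma1, gamma1D, mu, muD; otherwise it is equivalent to
   a subset of eps, kappa, mu2. In one direction the graph of [t] is mapped onto
   the path of the identity, in the other the edges forced by the identity are
   propagated along a walk. By Birkhoff's theorem a variety of the interval is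
   then determined by the identities of B it satisfies. *)

Set Implicit Arguments.
Unset Strict Implicit.
Unset Printing Implicit Defensive.

Local Open Scope classical_set_scope.

(** * Varieties and identities *)

Lemma smallest_is_variety (G : set algebra) : is_variety (generated G).
Proof.
split.
- move=> A B f KA hf sf K [vK GK]; case: (vK) => H _ _; apply: (H A B f) => //.
  exact: KA.
- move=> A B f KB hf jf K [vK GK]; case: (vK) => _ H _; apply: (H A B f) => //.
  exact: KB.
- move=> I A KA K [vK GK]; case: (vK) => _ _ H; apply: H => i; exact: KA.
Qed.

Lemma sub_generated (G : set algebra) : G `<=` generated G.
Proof. by move=> A GA K [_]; apply. Qed.

Lemma generated_sub (G K : set algebra) :
  is_variety K -> G `<=` K -> generated G `<=` K.
Proof. by move=> vK GK A; apply. Qed.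

Lemma eval_hom (A B : algebra) (f : A -> B) (v : nat -> A) t :
  hom f -> f (eval v t) = eval (fun n => f (v n)) t.
Proof.
case=> fA fM; elim: t => [//|s IHs t IHt|s IHs t IHt] /=.
  by rewrite fA IHs IHt.
by rewrite fM IHs IHt.
Qed.

Lemma eval_prod I (A : I -> algebra) (v : nat -> prod_alg A) t i :
  eval v t i = eval (fun n => v n i) t.
Proof.
elim: t => [//|s IHs t IHt|s IHs t IHt] /=; by rewrite -IHs -IHt.
Qed.

Lemma sat_is_variety (E : set identity) :
  is_variety [set A | forall e, E e -> sat A e].
Proof.
split.
- move=> A B f sA hf sf e Ee v.
  have [u uv] := choice (fun n => sf (v n)).
  have -> : v = fun n => f (u n) by apply: funext.
  by rewrite -!eval_hom // sA.
- move=> A B f sB hf jf e Ee v; apply: jf.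
  by rewrite !eval_hom // sB.
- move=> I A sA e Ee v; apply: functional_extensionality_dep => i.
  by rewrite !eval_prod sA.
Qed.

Lemma variety_setI (K L : set algebra) :
  is_variety K -> is_variety L -> is_variety (K `&` L).
Proof.
case=> K1 K2 K3 [L1 L2 L3]; split.
- by move=> A B f [KA LA] hf sf; split; [apply: (K1 A B f)|apply: (L1 A B f)].
- by move=> A B f [KA LA] hf sf; split; [apply: (K2 A B f)|apply: (L2 A B f)].
- by move=> I A KA; split; [apply: K3|apply: L3] => i; case: (KA i).
Qed.

Lemma adjoin_is_variety K E : is_variety K -> is_variety (adjoin K E).
Proof. by move=> vK; apply: variety_setI => //; apply: sat_is_variety. Qed.

Lemma generated_models G e : models (generated G) e <-> models G e.
Proof.
split=> [H A GA|H A gA]; first by apply: H; apply: sub_generated.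
have: [set A | forall e', [set e] e' -> sat A e'] A.
  apply: gA; split; first exact: sat_is_variety.
  by move=> B GB _ ->; apply: H.
exact.
Qed.

Lemma VV_models A e : models (VV A) e <-> sat A e.
Proof.
rewrite generated_models; split=> [|H B ->] //; exact.
Qed.

Lemma VV_sub A K : is_variety K -> VV A `<=` K <-> K A.
Proof.
move=> vK; split=> [|KA]; first by apply; apply: sub_generated.
by apply: generated_sub => // B ->.
Qed.

(** * Birkhoff's theorem *)

(** Variables come from an arbitrary type, because the proof of Birkhoff's theorem uses the elements
    of [A] themselves as variables. *)
Inductive xterm (X : Type) : Type :=
  | XVar of X | XAdd of xterm X & xterm X | XMul of xterm X & xterm X.

Section Birkhoff.
Variable A : algebra.
Let X : Type := A.

Fixpoint xeval (B : algebra) (f : X -> B) (t : xterm X) : B :=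
  match t with
  | XVar x => f x
  | XAdd s t => opA (xeval f s) (xeval f t)
  | XMul s t => opM (xeval f s) (xeval f t)
  end.

Fixpoint xvars (t : xterm X) : seq {classic X} :=
  match t with
  | XVar x => [:: x : {classic X}]
  | XAdd s t | XMul s t => xvars s ++ xvars t
  end.

Fixpoint rename (i : X -> nat) (t : xterm X) : term :=
  match t with
  | XVar x => Var (i x)
  | XAdd s t => Add (rename i s) (rename i t)
  | XMul s t => Mul (rename i s) (rename i t)
  end.

Lemma eval_rename (B : algebra) (v : nat -> B) i t :
  eval v (rename i t) = xeval (fun x => v (i x)) t.
Proof. by elim: t => [//|s IHs t IHt|s IHs t IHt] /=; rewrite IHs IHt. Qed.

Lemma xeval_eq (B : algebra) (f g : X -> B) t :
  (forall x : {classic X}, x \in xvars t -> f x = g x) -> xeval f t = xeval g t.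
Proof.
elim: t => [x H|s IHs t IHt H|s IHs t IHt H] /=.
- by apply: H; rewrite inE.
- by rewrite IHs ?IHt // => x xs; apply: H; rewrite mem_cat xs ?orbT.
- by rewrite IHs ?IHt // => x xs; apply: H; rewrite mem_cat xs ?orbT.
Qed.

(** Only finitely many variables occur in [s] and [t]. Numbering them gives an ordinary identity,
    which fails in [A] and hence in some member of [W]. *)
Lemma xseparate (W : set algebra) (s t : xterm X) :
  (forall e, models W e -> sat A e) ->
  xeval (B := A) id s <> xeval (B := A) id t ->
  exists (B : algebra) (f : X -> B), W B /\ xeval f s <> xeval f t.
Proof.
move=> HW st; pose l := xvars s ++ xvars t.
pose i (x : X) := index (x : {classic X}) l.
pose x0 : {classic X} := inhabited_witness (Defs.nonempty A).
pose k (n : nat) : X := nth x0 l n.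
apply/not_existsP => none; apply: st.
have kiK u : {subset xvars u <= l} -> xeval (B := A) id u = eval k (rename i u).
  move=> ul; rewrite eval_rename; apply: xeval_eq => x /ul xl.
  by rewrite /k /i nth_index.
rewrite !kiK; [|by move=> x; rewrite mem_cat orbC => ->
  |by move=> x; rewrite mem_cat => ->].
apply: (HW (rename i s, rename i t)) => B WB v /=; rewrite !eval_rename.
apply/not_notP => neq; apply: (none B); by exists (fun x => v (i x)).
Qed.

(** The product [Pr] has one factor for each pair of terms with distinct values in [A]. Terms that
    agree in the subalgebra [S] of values therefore agree in [A], and [A] is a quotient of [S]. *)
Theorem Birkhoff (W : set algebra) :
  is_variety W -> (forall e, models W e -> sat A e) -> W A.
Proof.
move=> [WH WS WP] HW.
pose I := {st : xterm X * xterm X | xeval (B := A) id st.1 <> xeval (B := A) id st.2}.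
have sep (i : I) : {B : algebra & {f : X -> B |
    W B /\ xeval f (sval i).1 <> xeval f (sval i).2}}.
  case: i => [[s t] /= st].
  by have [B H] := cid (xseparate HW st); exists B; apply: cid.
pose B i := projT1 (sep i); pose f i : X -> B i := sval (projT2 (sep i)).
have WB i : W (B i) by rewrite /B; case: (projT2 (sep i)) => ? [].
have fP i : xeval (f i) (sval i).1 <> xeval (f i) (sval i).2.
  by rewrite /f /B; case: (projT2 (sep i)) => ? [].
pose Pr := prod_alg B; pose F (x : X) : Pr := fun i => f i x.
have xF t i : xeval F t i = xeval (f i) t.
  by elim: t => [//|s IHs t IHt|s IHs t IHt] /=; rewrite -IHs -IHt.
have wd s t : xeval F s = xeval F t -> xeval (B := A) id s = xeval (B := A) id t.
  move=> E; apply/not_notP => st; pose i : I := exist _ (s, t) st.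
  by apply: (fP i); rewrite -!xF /= E.
pose C := {g : Pr | exists t, g = xeval F t}.
have cA (g h : C) : exists t, opA (sval g) (sval h) = xeval F t.
  by case: (svalP g) (svalP h) => [s ->] [t ->]; exists (XAdd s t).
have cM (g h : C) : exists t, opM (sval g) (sval h) = xeval F t.
  by case: (svalP g) (svalP h) => [s ->] [t ->]; exists (XMul s t).
have cI : inhabited C.
  case: (Defs.nonempty A) => x; constructor.
  by exists (F x); exists (XVar x).
pose S := @Algebra C (fun g h => exist _ _ (cA g h)) (fun g h => exist _ _ (cM g h)) cI.
have WC : W S.
  apply: (WS S Pr (fun g : C => sval g)) => //; first exact: WP.
  move=> [g Pg] [h Ph] /= gh; move: Pg Ph; rewrite gh => Pg Ph.
  by congr exist; apply: Prop_irrelevance.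
pose tm (g : C) := sval (cid (svalP g)).
have tmE (g : C) : sval g = xeval F (tm g) by rewrite /tm; case: cid.
apply: (WH S A (fun g : C => xeval (B := A) id (tm g))) => //.
  split=> g h; last first.
    rewrite -[RHS]/(xeval (B := A) id (XMul (tm g) (tm h))).
    by apply: wd; rewrite -tmE /= -!tmE.
  rewrite -[RHS]/(xeval (B := A) id (XAdd (tm g) (tm h))).
  by apply: wd; rewrite -tmE /= -!tmE.
move=> x; have Fx : exists t, F x = xeval F t by exists (XVar x).
exists (exist (fun g : Pr => exists t, g = xeval F t) (F x) Fx).
rewrite -[RHS]/(xeval (B := A) id (XVar x)).
by apply: wd; rewrite -tmE.
Qed.

End Birkhoff.

(** * Nilpotent semirings *)

Definition le (A : algebra) (x y : A) : Prop := opA x y = y.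

Local Notation "x [+] y" := (opA x y) (at level 50, left associativity).
Local Notation "x [*] y" := (opM x y) (at level 40, left associativity).
Local Notation "x [<=] y" := (le x y) (at level 70, no associativity).

Record nilsr (A : algebra) (o : A) : Prop := Nilsr {
  addC : forall x y : A, x [+] y = y [+] x;
  addA : forall x y z : A, x [+] (y [+] z) = x [+] y [+] z;
  addI : forall x : A, x [+] x = x;
  mulC : forall x y : A, x [*] y = y [*] x;
  mulDl : forall x y z : A, (x [+] y) [*] z = x [*] z [+] y [*] z;
  add_top : forall x : A, x [+] o = o;
  mul_top : forall x : A, o [*] x = o;
  mul_sq : forall x : A, x [*] x = o;
  mul3 : forall x y z : A, x [*] y [*] z = o }.

(* A term is a sum of words: variables, products of two variables, and words
   that vanish on nilpotent semirings. The last are recorded by [bad], the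
   first two form a graph [edg] with a set [lin] of marked vertices. *)
Fixpoint lin (t : term) (x : nat) : Prop :=
  match t with
  | Var y => x = y
  | Add s t => lin s x \/ lin t x
  | Mul _ _ => False
  end.

Fixpoint has_mul (t : term) : Prop :=
  match t with
  | Var _ => False
  | Add s t => has_mul s \/ has_mul t
  | Mul _ _ => True
  end.

Fixpoint edg (t : term) (x y : nat) : Prop :=
  match t with
  | Var _ => False
  | Add s t => edg s x y \/ edg t x y
  | Mul s t => (lin s x /\ lin t y) \/ (lin s y /\ lin t x)
  end.

Fixpoint bad (t : term) : Prop :=
  match t with
  | Var _ => False
  | Add s t => bad s \/ bad t
  | Mul s t => has_mul s \/ has_mul t
  end.

Lemma edg_sym t x y : edg t x y -> edg t y x.
Proof. by elim: t => [//|s IHs t IHt|s _ t _] /=; tauto. Qed.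

Inductive word := W1 of nat | W2 of nat & nat | W0.

Definition wval (A : algebra) (o : A) (g : nat -> A) (w : word) : A :=
  match w with W1 x => g x | W2 x y => g x [*] g y | W0 => o end.

Definition occurs (t : term) (w : word) : Prop :=
  match w with W1 x => lin t x | W2 x y => edg t x y | W0 => bad t end.

Section Nilsr.
Variables (A : algebra) (o : A).
Hypothesis nA : nilsr o.

Lemma le_refl (x : A) : x [<=] x. Proof. exact: addI nA x. Qed.

Lemma le_trans (y x z : A) : x [<=] y -> y [<=] z -> x [<=] z.
Proof. by rewrite /le => xy <-; rewrite (addA nA) xy. Qed.

Lemma le_anti (x y : A) : x [<=] y -> y [<=] x -> x = y.
Proof. by rewrite /le => xy <-; rewrite (addC nA). Qed.

Lemma le_top (x : A) : x [<=] o. Proof. exact: add_top nA x. Qed.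

Lemma add_le (x y z : A) : x [+] y [<=] z <-> x [<=] z /\ y [<=] z.
Proof.
split=> [H|[xz yz]]; last by rewrite /le -(addA nA) yz xz.
split; apply: (le_trans _ H).
  by rewrite /le (addA nA) (addI nA).
by rewrite /le (addC nA x) (addA nA) (addI nA).
Qed.

(** Distributivity expands the product over the words of [s]; a word that is already a product
    yields [o], by nilpotency. *)
Lemma eval_mul_le (g : nat -> A) s (z T : A) :
  eval g s [*] z [<=] T <->
  (has_mul s -> o [<=] T) /\ (forall x, lin s x -> g x [*] z [<=] T).
Proof.
elim: s => [x|s IHs t IHt|s _ t _] /=.
- by split=> [H|[_ H]]; [split=> // y ->|apply: H].
- rewrite (mulDl nA) add_le IHs IHt; split=> [[[H1 H2] [H3 H4]]|[H1 H2]].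
    by split=> [[]|x []]; auto.
  by split; split; auto.
- by rewrite (mul3 nA); split=> [H|[H _]]; [split|apply: H].
Qed.

Lemma has_mul_or_lin s : has_mul s \/ exists x, lin s x.
Proof.
elim: s => [x|s [sm|[x sx]] t _|s _ t _] /=;
  by [right; exists x|left; left|right; exists x; left|left].
Qed.

(** By distributivity a term has the value of the sum of its words, and a sum is the join of its
    summands. *)
Lemma eval_le (g : nat -> A) t (T : A) :
  eval g t [<=] T <-> forall w, occurs t w -> wval o g w [<=] T.
Proof.
elim: t => [x|s IHs t IHt|s _ t _] /=.
- by split=> [H [y /= ->|//|//]|/(_ (W1 x))]; last by apply.
- rewrite add_le IHs IHt; split=> [[H1 H2] w|H].
    by case: w => [x|x y|] /= []; [move=> /(H1 (W1 _))|move=> /(H2 (W1 _))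
      |move=> /(H1 (W2 _ _))|move=> /(H2 (W2 _ _))
      |move=> /(H1 W0)|move=> /(H2 W0)].
  by split=> -[x|x y|] w; [apply: (H (W1 x))|apply: (H (W2 x y))|apply: (H W0)
    |apply: (H (W1 x))|apply: (H (W2 x y))|apply: (H W0)]; rewrite /=; auto.
- rewrite eval_mul_le.
  have E x : g x [*] eval g t [<=] T <->
      (has_mul t -> o [<=] T) /\ (forall y, lin t y -> g x [*] g y [<=] T).
    rewrite (mulC nA) eval_mul_le; split=> -[H1 H2]; split=> // y ty.
      by rewrite (mulC nA); apply: H2.
    by rewrite (mulC nA); apply: H2.
  split=> [[H1 H2]|H]; last first.
    split=> [sm|x sx]; first by apply: (H W0); left.
    apply/E; split=> [tm|y ty]; first by apply: (H W0); right.
    by apply: (H (W2 x y)); left.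
  case=> [//|x y|] /=.
    case=> -[sx ty]; first by apply: (proj2 (proj1 (E x) (H2 x sx))).
    by rewrite (mulC nA); apply: (proj2 (proj1 (E y) (H2 y sx))).
  case=> [//|tm]; case: (has_mul_or_lin s) => [//|[x sx]].
  exact: (proj1 (proj1 (E x) (H2 x sx))).
Qed.

Lemma occurs_le (g : nat -> A) t w : occurs t w -> wval o g w [<=] eval g t.
Proof. by move: w; apply/eval_le/le_refl. Qed.

Lemma sat_preceq s t :
  sat A (preceq s t) <-> forall g : nat -> A, eval g s [<=] eval g t.
Proof. by []. Qed.

End Nilsr.

(** * The seven identities *)

(** All seven right-hand sides contain the path [ab + bc + cd]; the flags tell whether [a], [b], [c]
    and [D(t,u)] are added to it. *)
Definition pattern (l : label) : bool * bool * bool * bool :=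
  match l with
  | eps => (true, true, true, false)
  | gamma1D => (true, false, true, true)
  | gamma1 => (true, false, true, false)
  | kappa => (true, true, false, false)
  | mu2 => (false, true, true, false)
  | muD => (false, true, false, true)
  | mu => (false, true, false, false)
  end.

(** [T] runs over all upper bounds of the right-hand side, so the condition applies directly to
    products already known to lie below [T]. *)
Definition closed (A : algebra) (p : bool * bool * bool * bool) : Prop :=
  let '(ka, kb, kc, kD) := p in
  forall T a b c d t u : A,
    (ka -> a [<=] T) -> (kb -> b [<=] T) -> (kc -> c [<=] T) ->
    a [*] b [<=] T -> b [*] c [<=] T -> c [*] d [<=] T ->
    (kD -> [/\ t [<=] T, u [<=] T & t [*] u [<=] T]) ->
    a [*] d [<=] T.

Lemma sat_closed (A : algebra) (o : A) l :
  nilsr o -> sat A (ident l) <-> closed A (pattern l).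
Proof.
move=> nA; have lub := add_le nA; split=> [H|H v].
  case: l H => H T a b c d t u Ha Hb Hc ab bc cd HD;
  have := H (fun n => nth a [:: a; b; c; d; t; u] n);
  move=> /= /(le_trans nA); apply; rewrite !lub;
  try (case: HD => // ? ? ?); repeat split; by [exact: Ha|exact: Hb|exact: Hc|].
by case: l H => /= H; apply: (H _ (v 0) (v 1) (v 2) (v 3) (v 4) (v 5)) => //;
  try move=> _; try split; match goal with |- le _ ?T => have := le_refl nA T end;
  rewrite !lub; tauto.
Qed.

(** Each rule combines some of three moves: adding summands on the right, taking a marked edge [ab]
    or [bc] for [D], and reading the path backwards. *)
Lemma rule_sound (A : algebra) (o : A) e f :
  nilsr o -> rule e f -> closed A (pattern e) -> closed A (pattern f).
Proof.
move=> nA; have C := mulC nA.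
case=> H T a b c d t u Ha Hb Hc ab bc cd HD.
- by apply: (H T a b c d a b) => // _; split; [exact: Ha|exact: Hb|].
- exact: (H T a b c d t u).
- exact: (H T a b c d t u).
- exact: (H T a b c d t u).
- by rewrite C; apply: (H T d c b a t u) => //; rewrite C.
- by apply: (H T a b c d a b) => // _; split; [exact: Ha|exact: Hb|].
- by apply: (H T a b c d b c) => // _; split; [exact: Hb|exact: Hc|].
- by rewrite C; apply: (H T d c b a t u) => //; rewrite C.
- exact: (H T a b c d t u).
Qed.

(** * Finite nilpotent semirings *)

Section Table.
Variables (X : Type) (es : seq X) (idx : X -> nat).
Hypothesis es_all : forall (P : pred X), all P es -> forall x, P x.
Hypothesis idx_inj : injective idx.
Variables (add mul : X -> X -> X) (o c : X).

Definition tab : algebra := @Algebra X add mul (inhabits o).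

Let eqx x y := idx x == idx y.
Let lex x y := eqx (add x y) y.
Let mark x := lex x c.
Let adj x y := eqx (mul x y) c.
Let each (P : pred X) := all P es.
Let some (P : pred X) := has P es.

Lemma eachP (P : pred X) : reflect (forall x, P x) (each P).
Proof.
apply: (iffP idP) => [/es_all //|H].
by rewrite /each (@eq_all _ P predT) ?all_predT // => x; rewrite H.
Qed.

Lemma someP (P : pred X) : reflect (exists x, P x) (some P).
Proof.
apply: (iffP idP) => [|[x Px]].
  by rewrite /some; elim: es => [//|x s IH] /= /orP[Px|/IH]; [exists x|].
by apply/negPn; rewrite /some -all_predC; apply/negP => /es_all /(_ x) /=; rewrite Px.
Qed.

Lemma eqxP x y : reflect (x = y) (eqx x y).
Proof. by apply: (iffP eqP) => [/idx_inj|->]. Qed.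

(* All products are [c] or [o], and only [c] and [o] lie above [c]. *)
Definition goodb :=
  [&& each (fun x => each (fun y =>
        [&& eqx (add x y) (add y x), eqx (mul x y) (mul y x)
          & eqx (mul x y) c || eqx (mul x y) o])),
      each (fun x => [&& eqx (add x x) x, eqx (add x o) o, eqx (mul o x) o,
        eqx (mul x x) o & lex c x ==> eqx x c || eqx x o]),
      each (fun x => each (fun y => each (fun z =>
        [&& eqx (add x (add y z)) (add (add x y) z),
            eqx (mul (add x y) z) (add (mul x z) (mul y z))
          & eqx (mul (mul x y) z) o]))) & ~~ eqx c o].

(** Testing [T = c] is enough: a bound of a product is [c] or [o], and everything lies below [o]. As
    [D] shares no variable with the path, it only asks for one marked edge somewhere. *)
Definition closedb (p : bool * bool * bool * bool) :=
  let '(ka, kb, kc, kD) := p in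
  (kD ==> some (fun t => mark t && some (fun u => mark u && adj t u))) ==>
  each (fun a => (ka ==> mark a) ==>
  each (fun b => (kb ==> mark b) && adj a b ==>
  each (fun c => (kc ==> mark c) && adj b c ==>
  each (fun d => adj c d ==> adj a d)))).

Hypothesis good : goodb.

Lemma tab_nilsr : @nilsr tab o.
Proof.
case/and4P: good => /eachP H1 /eachP H2 /eachP H3 _.
split=> /= [x y|x y z|x|x y|x y z|x|x|x|x y z]; apply/eqxP.
- by have /eachP/(_ y)/and3P[] := H1 x.
- by have /eachP/(_ y)/eachP/(_ z)/and3P[] := H3 x.
- by have /and5P[] := H2 x.
- by have /eachP/(_ y)/and3P[] := H1 x.
- by have /eachP/(_ y)/eachP/(_ z)/and3P[] := H3 x.
- by have /and5P[] := H2 x.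
- by have /and5P[] := H2 x.
- by have /and5P[] := H2 x.
- by have /eachP/(_ y)/eachP/(_ z)/and3P[] := H3 x.
Qed.

Lemma lexP (x y : tab) : reflect (x [<=] y) (lex x y).
Proof. exact: eqxP. Qed.

Lemma above_c (T : tab) : @le tab c T -> T = c \/ T = o.
Proof.
case/and4P: good => _ /eachP/(_ T)/and5P[_ _ _ _ /implyP H] _ _.
by move/lexP/H/orP => [] /eqxP; [left|right].
Qed.

Lemma c_neq_o : c <> o.
Proof. by case/and4P: good => _ _ _ /eqxP. Qed.

Lemma prod_le (x y : tab) T : T <> o -> x [*] y [<=] T -> mul x y = c.
Proof.
case/and4P: good => /eachP/(_ x)/eachP/(_ y)/and3P[_ _ /orP[/eqxP //|/eqxP xy]].
move=> _ _ _ To; rewrite /le /= xy => E; case: To.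
exact: etrans (esym E) (etrans (addC tab_nilsr o T) (add_top tab_nilsr T)).
Qed.

Lemma prod_le_c (x y : tab) : reflect (@le tab (x [*] y) c) (adj x y).
Proof.
apply: (iffP (eqxP _ _)) => [/= ->|]; first exact: (le_refl tab_nilsr).
by apply: prod_le; apply: c_neq_o.
Qed.

Lemma closedP p : reflect (closed tab p) (closedb p).
Proof.
case: p => [[[ka kb] kc] kD] /=; apply: (iffP idP) => [/implyP H|H].
  move=> T x y z w t u kx ky kz xy yz zw HD.
  have [->|To] := pselect (T = o); first exact: (le_top tab_nilsr).
  have Tc : T = c by case: (@above_c T) => //; rewrite -(prod_le To xy).
  subst T; have D : kD ==> some (fun t => mark t && some (fun u => mark u && adj t u)).
    apply/implyP => /HD [/lexP tc /lexP uc /prod_le_c tu].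
    apply/someP; exists t; rewrite /mark tc; apply/someP; exists u.
    by rewrite /mark uc.
  have h (k : bool) (v : tab) : (k -> @le tab v c) -> k ==> mark v.
    by move=> kv; apply/implyP => /kv /lexP.
  move: xy yz zw => /prod_le_c xy /prod_le_c yz /prod_le_c zw; apply/prod_le_c.
  have /eachP/(_ x)/implyP/(_ (h _ _ kx)) := H D.
  move=> /eachP/(_ y)/implyP; rewrite (h _ _ ky) xy => /(_ isT).
  move=> /eachP/(_ z)/implyP; rewrite (h _ _ kz) yz => /(_ isT).
  by move=> /eachP/(_ w)/implyP/(_ zw).
have h (k : bool) (v : tab) : k ==> mark v -> k -> @le tab v c.
  by move=> /implyP kv /kv /lexP.
apply/implyP => D.
have [t [u tu]] : exists t u : tab, kD -> [/\ @le tab t c, @le tab u c & @le tab (t [*] u) c].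
  case: kD {H} D => [/someP[t /andP[tc /someP[u /andP[uc tu]]]]|_].
    by exists t, u => _; split; [exact/lexP|exact/lexP|exact/prod_le_c].
  by exists o, o.
apply/eachP => x; apply/implyP => kx; apply/eachP => y; apply/implyP => /andP[ky xy].
apply/eachP => z; apply/implyP => /andP[kz yz]; apply/eachP => w; apply/implyP => zw.
apply/prod_le_c; apply: (H c x y z w t u) => //;
  first [exact/prod_le_c|exact: h].
Qed.

End Table.

(** * Membership in the variety *)

(* [h] is only a lax homomorphism: it bounds the words below [u] by [r]. *)
Definition separates (A B : algebra) (o : B) (u : A) (h : A -> B) (r : B) : Prop :=
  [/\ forall z, z [<=] u -> h z [<=] r,
      forall z w, z [*] w [<=] u -> h z [*] h w [<=] r & ~ o [<=] r].

(** If a word of [s'] is not below the value [u] of [t'], some [h] separates it from [u]: the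
    valuation [h \o g] in [B] keeps [t'] below [r] but not that word, against the identity. *)
Lemma separated_sat (A B : algebra) (oA : A) (oB : B) :
  nilsr oA -> nilsr oB ->
  (forall u : A, ~ oA [<=] u -> exists h r, separates oB u h r) ->
  (forall u z : A, ~ z [<=] u -> exists h r, separates oB u h r /\ ~ h z [<=] r) ->
  (forall u z w : A, ~ z [*] w [<=] u ->
     exists h r, separates oB u h r /\ ~ h z [*] h w [<=] r) ->
  forall e, sat B e -> sat A e.
Proof.
move=> nA nB H0 H1 H2 [s t] sB g /=.
have half s' t' : sat B (s', t') -> eval g s' [<=] eval g t'.
  move=> {s t} {}sB; set u := eval g t'.
  apply/(eval_le nA) => w sw; apply/not_notP => wu.
  have ou : ~ oA [<=] u.
    by move=> ou; apply: wu; apply: (le_trans nA) ou; apply: (le_top nA).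
  have sep h r : separates oB u h r -> wval oB (h \o g) w [<=] r.
    case=> h1 h2 h0; apply: (le_trans nB (y := eval (h \o g) s')).
      exact: occurs_le nB _ _ _ sw.
    rewrite (sB (h \o g)) /=; apply/(eval_le nB) => w' tw'.
    have := occurs_le nA g tw'; rewrite -/u.
    by case: w' {tw'} => [x|x y|] /= H; [apply: h1|apply: h2|].
  case: w sw wu sep => [x|x y|] /= _ wu sep.
  - by have [h [r [S]]] := H1 _ _ wu; apply; apply: sep.
  - by have [h [r [S]]] := H2 _ _ _ wu; apply; apply: sep.
  - by have [h [r S]] := H0 _ ou; have := sep _ _ S; case: S.
by apply: (le_anti nA); apply: half => // v; rewrite (sB v).
Qed.

Local Notation esM := [:: ma; mb; mp; mq; mc; m0].

Lemma M_all (P : pred M) : all P esM -> forall x, P x.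
Proof. by move=> /and5P[? ? ? ? /and3P[? ? _]] []. Qed.

Definition idxM (x : M) : nat :=
  match x with m0 => 0 | mc => 1 | mp => 2 | mq => 3 | ma => 4 | mb => 5 end.
Lemma idxM_inj : injective idxM. Proof. by case; case. Qed.

Definition leE i j (x y : M) : bool :=
  match x, y with
  | _, m0 => true
  | ma, ma | ma, mp | mp, mp | mb, mb | mb, mq | mq, mq | mc, mc => true
  | ma, mc => (0 < i)
  | mp, mc => (1 < i)
  | mb, mc => (0 < j)
  | mq, mc => (1 < j)
  | _, _ => false
  end.

(* The list is a linear extension of the order, so the first upper bound is
   the join. *)
Definition addE i j (x y : M) : M :=
  head m0 [seq z <- [:: ma; mb; mp; mq; mc] | leE i j x z && leE i j y z].

Lemma addM_E i j : addM i j = addE i j.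
Proof.
apply: funext => x; apply: funext => y.
apply: is_join_uniq (addM_join i j x y) _.
rewrite /is_join forallME !leM_explicit.
by case: i => [|[|i]]; case: j => [|[|j]]; case: x; case: y.
Qed.

Lemma Rsr_tab i j : Rsr i j = tab (addE i j) mulM m0.
Proof. by rewrite /Rsr addM_E. Qed.

Local Notation goodM i j := (goodb esM idxM (addE i j) mulM m0 mc).

Lemma Rsr_good i j : goodM i j.
Proof. by case: i => [|[|i]]; case: j => [|[|j]]; vm_compute. Qed.

Lemma Rsr_nilsr i j : @nilsr (Rsr i j) m0.
Proof. by have := tab_nilsr M_all idxM_inj (Rsr_good i j); rewrite -addM_E. Qed.

Lemma Rsr_closed i j p :
  closed (Rsr i j) p <-> closedb esM idxM (addE i j) mulM mc p.
Proof.
rewrite Rsr_tab; apply: rwP; exact: (closedP M_all idxM_inj (Rsr_good i j)).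
Qed.

Section TableInV.
Variables (X : Type) (es : seq X) (idx : X -> nat).
Hypothesis es_all : forall (P : pred X), all P es -> forall x, P x.
Hypothesis idx_inj : injective idx.
Variables (add mul : X -> X -> X) (o c : X).
Hypothesis good : goodb es idx add mul o c.

Let lex x y := idx (add x y) == idx y.
Let leR := leE 1 2.

Definition separatesb (u : X) (hr : (X -> M) * M) :=
  [&& all (fun z => lex z u ==> leR (hr.1 z) hr.2) es,
      all (fun z => all (fun w =>
        lex (mul z w) u ==> leR (mulM (hr.1 z) (hr.1 w)) hr.2) es) es
    & idxM hr.2 != 0].

(** [hs u] lists mere candidates, and those failing [separatesb] are discarded. For [u] above [o]
    nothing has to be separated. *)
Definition in_Vb (hs : X -> seq ((X -> M) * M)) :=
  all (fun u => lex o u ||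
    let good := [seq hr <- hs u | separatesb u hr] in
    [&& has predT good,
        all (fun z => lex z u || has (fun hr => ~~ leR (hr.1 z) hr.2) good) es
      & all (fun z => all (fun w => lex (mul z w) u ||
          has (fun hr => ~~ leR (mulM (hr.1 z) (hr.1 w)) hr.2) good) es) es]) es.

Lemma in_VP hs : in_Vb hs -> calV (tab add mul o).
Proof.
move=> H; have nT := tab_nilsr es_all idx_inj good.
have leRP (x y : M) : reflect (@le (Rsr 1 2) x y) (leR x y).
  by rewrite /le /= addM_E; apply: (iffP idP); case: x; case: y.
have lexP' (x y : tab add mul o) : reflect (x [<=] y) (lex x y).
  exact: (lexP idx_inj).
have sepP u hr : separatesb u hr -> @separates (tab add mul o) (Rsr 1 2) m0 u hr.1 hr.2.
  case/and3P => /es_all s1 /es_all s2 s0; split.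
  - by move=> z /lexP' zu; have /implyP/(_ zu)/leRP := s1 z.
  - by move=> z w /lexP' zu; have /es_all/(_ w)/implyP/(_ zu)/leRP := s2 z.
  - by move=> /leRP; case: hr.2 s0.
have Hgood (T : Type) (s : seq T) (P Q : pred T) :
    has P [seq x <- s | Q x] -> exists x, Q x /\ P x.
  elim: s => [//|x s IH] /=; case: ifP => [Qx|_ /IH //] /= /orP[Px|/IH //].
  by exists x.
apply: Birkhoff; first exact: smallest_is_variety.
move=> e /VV_models; apply: (separated_sat nT (Rsr_nilsr 1 2)).
- move=> u ou; have := es_all H u => /orP[/lexP' //|/and3P[]].
  by case/Hgood => -[h r] [/sepP S _] _ _; exists h, r.
- move=> u z zu; have := es_all H u => /orP[/lexP' ou|/and3P[_ /es_all/(_ z) K _]].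
    by case: zu; apply: (le_trans nT) ou; apply: (le_top nT).
  case/orP: K => [/lexP' //|/Hgood[[h r] [/sepP S /negP N]]].
  by exists h, r; split=> // /leRP.
- move=> u z w zu.
  have := es_all H u => /orP[/lexP' ou|/and3P[_ _ /es_all/(_ z)/es_all/(_ w) K]].
    by case: zu; apply: (le_trans nT) ou; apply: (le_top nT).
  case/orP: K => [/lexP' //|/Hgood[[h r] [/sepP S /negP N]]].
  by exists h, r; split=> // /leRP.
Qed.

End TableInV.

(** * Countermodels from graphs *)

(* The graph has eight vertices, a path v1 - ... - v4, prolonged to v5 when
   [long], and a path ve - vf - vg. Distributivity requires sums of vertices
   with a common neighbour; the other sums of vertices are [gc] if all of them
   are marked, and [g0] otherwise. *)
Inductive gel := g0 | gc | v1 | v2 | v3 | v4 | v5 | ve | vf | vg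
  | v13 | v35 | v24 | veg.

Definition esG :=
  [:: v1; v2; v3; v4; v5; ve; vf; vg; v13; v35; v24; veg; gc; g0].

Definition idxG (x : gel) : nat :=
  match x with g0 => 0 | gc => 1 | v1 => 2 | v2 => 3 | v3 => 4 | v4 => 5
  | v5 => 6 | ve => 7 | vf => 8 | vg => 9 | v13 => 10 | v35 => 11 | v24 => 12
  | veg => 13 end.

Lemma idxG_inj : injective idxG. Proof. by case; case. Qed.

Lemma G_all (P : pred gel) : all P esG -> forall x, P x.
Proof.
by rewrite /= => /and5P[? ? ? ? /and5P[? ? ? ? /and5P[? ? ? ? /and3P[? ? _]]]] [].
Qed.

Definition parts (x : gel) : seq gel :=
  match x with
  | g0 | gc => [::]
  | v13 => [:: v1; v3] | v35 => [:: v3; v5] | v24 => [:: v2; v4]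
  | veg => [:: ve; vg]
  | _ => [:: x]
  end.

Definition part_of (x y : gel) : bool :=
  all (fun u => has (fun v => idxG u == idxG v) (parts y)) (parts x).

Definition link (long : bool) (x y : gel) : bool :=
  match x, y with
  | v1, v2 | v2, v1 | v2, v3 | v3, v2 | v3, v4 | v4, v3
  | ve, vf | vf, ve | vf, vg | vg, vf => true
  | v4, v5 | v5, v4 => long
  | _, _ => false
  end.

Definition is_sum (x : gel) : bool := ~~ nilp (parts x).

Section GraphAlgebra.
Variables (long : bool) (S : pred gel).

Definition markG (x : gel) : bool :=
  match x with g0 => false | gc => true | _ => all S (parts x) end.

Definition addG (x y : gel) : gel :=
  if idxG x == idxG y then x else
  head (if markG x && markG y then gc else g0)
    [seq z <- esG | [&& is_sum x, is_sum y, part_of x z & part_of y z]].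

Definition mulG (x y : gel) : gel :=
  if [&& is_sum x, is_sum y
      & all (fun u => all (link long u) (parts y)) (parts x)]
  then gc else g0.

Definition galg : algebra := tab addG mulG g0.

End GraphAlgebra.

Definition nbrM (x : M) : seq M :=
  match x with
  | mp => [:: mb] | mb => [:: mp; ma] | ma => [:: mb; mq] | mq => [:: ma]
  | _ => [::]
  end.

Fixpoint walks (n : nat) (x : M) : seq (seq M) :=
  if n is n'.+1 then [seq x :: w | y <- nbrM x, w <- walks n' y] else [:: [:: x]].

Definition all_walks n := flatten [seq walks n x | x <- [:: mp; mb; ma; mq]].

(** The walks are the images of the two paths. On the short path [v5] is isolated and receives the
    default [mp], the only vertex not below [mc] in [Rsr 1 2]. *)
Definition of_walks (w s : seq M) (x : gel) : M :=
  let add := addE 1 2 in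
  match x with
  | v13 => add (nth mp w 0) (nth mp w 2) | v35 => add (nth mp w 2) (nth mp w 4)
  | v24 => add (nth mp w 1) (nth mp w 3) | veg => add (nth mp s 0) (nth mp s 2)
  | g0 => m0 | gc => mc
  | v1 => nth mp w 0 | v2 => nth mp w 1 | v3 => nth mp w 2 | v4 => nth mp w 3
  | v5 => nth mp w 4
  | ve => nth mp s 0 | vf => nth mp s 1 | vg => nth mp s 2
  end.

(** Any [u] other than [gc] and [g0] has only vertices and their sums below it. Sending these to
    [ma] and the rest to [m0] separates, since [ma] has square [m0]. *)
Definition homsG (long : bool) (u : gel) : seq ((gel -> M) * M) :=
  if u is gc then
    [seq (of_walks w s, mc) | w <- all_walks (if long then 4 else 3), s <- all_walks 2]
  else [:: (fun z => if is_sum z && part_of z u then ma else m0, ma)].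

Definition marks_of (l : label) (x : gel) : bool :=
  let '(ka, kb, kc, kD) := pattern l in
  match x with
  | v1 => ka | v2 => kb | v3 => kc | ve | vf => kD | _ => false
  end.

(** The right-hand side of [ident l] read as a marked graph, with [v1] to [v4] for [a] to [d] and
    [ve], [vf] for [t], [u]; hence a countermodel to [ident l]. *)
Definition G_label (l : label) : algebra := galg false (marks_of l).

Definition marksP (x : gel) : bool :=
  match x with v1 | v5 | ve | vf => true | _ => false end.

(** All neighbours of a marked vertex have the same neighbours, which gives [mu]; yet [v1], which is
    marked, and [v4] are joined by an odd walk without being adjacent. *)
Definition G_P : algebra := galg true marksP.

Lemma G_label_good l : goodb esG idxG (addG (marks_of l)) (mulG false) g0 gc.
Proof. by case: l; vm_compute. Qed.

Lemma G_P_good : goodb esG idxG (addG marksP) (mulG true) g0 gc.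
Proof. by vm_compute. Qed.

Lemma G_label_V l : calV (G_label l).
Proof.
apply: (@in_VP _ _ _ G_all idxG_inj _ _ _ _ (G_label_good l) (homsG false)).
by case: l; vm_compute.
Qed.

Lemma G_P_V : calV G_P.
Proof.
apply: (@in_VP _ _ _ G_all idxG_inj _ _ _ _ G_P_good (homsG true)).
by vm_compute.
Qed.

Lemma G_nilsr l : @nilsr (G_label l) g0.
Proof. exact: (tab_nilsr G_all idxG_inj (G_label_good l)). Qed.

Lemma G_P_nilsr : @nilsr G_P g0.
Proof. exact: (tab_nilsr G_all idxG_inj G_P_good). Qed.

Definition consequences (e : label) : seq label :=
  match e with
  | eps => [:: eps]
  | gamma1D => [:: gamma1D; eps]
  | gamma1 => [:: gamma1; gamma1D; eps]
  | kappa => [:: kappa; eps]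
  | mu2 => [:: mu2; eps]
  | muD => [:: muD; gamma1D; kappa; mu2; eps]
  | mu => labels
  end.

Lemma G_label_sat l f : sat (G_label l) (ident f) <-> l \notin consequences f.
Proof.
rewrite (sat_closed _ (G_nilsr l)).
suff <- : closedb esG idxG (addG (marks_of l)) (mulG false) gc (pattern f)
    = (l \notin consequences f).
  apply: rwP.
  exact: (closedP G_all idxG_inj (G_label_good l)).
by case: l; case: f; vm_compute.
Qed.

Lemma G_P_calP : calP G_P.
Proof.
split; first exact: G_P_V.
move=> _ [f -> <-]; apply/(sat_closed _ G_P_nilsr).
by apply/(closedP G_all idxG_inj G_P_good); vm_compute.
Qed.

(** * The semirings R_01 and R_11 *)

Definition mapM (a b p q : M) (x : M) : M :=
  match x with ma => a | mb => b | mp => p | mq => q | _ => x end.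

Lemma calV_Rsr i j (hs : M -> seq ((M -> M) * M)) :
  in_Vb esM idxM (addE i j) mulM m0 hs -> calV (Rsr i j).
Proof.
by move=> H; rewrite Rsr_tab; apply: (in_VP M_all idxM_inj (Rsr_good i j) H).
Qed.

Lemma calV_R01 : calV (Rsr 0 1).
Proof.
(* Among the vertices only [mp] is not below [mc] in [Rsr 1 2]; the two further maps send [ma] and
   [mq] there. *)
apply: (@calV_Rsr _ _ (fun u => if u is mc then
    [:: (id, mc); (mapM mp mb mp mb, mc); (mapM mb ma mb mp, mc)] else [:: (id, u)])).
by vm_compute.
Qed.

Lemma calV_R11 : calV (Rsr 1 1).
Proof.
(* The second map reverses the path and so sends [mq] to [mp]. *)
apply: (@calV_Rsr _ _ (fun u => if u is mc then
    [:: (id, mc); (mapM mb ma mq mp, mc)] else [:: (id, u)])).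
by vm_compute.
Qed.

Lemma R01_sat f : sat (Rsr 0 1) (ident f) <-> f != mu.
Proof.
by rewrite (sat_closed _ (Rsr_nilsr 0 1)) Rsr_closed; case: f; vm_compute.
Qed.

Lemma R11_sat f :
  sat (Rsr 1 1) (ident f) <-> f \in [:: eps; gamma1D; gamma1; kappa].
Proof.
by rewrite (sat_closed _ (Rsr_nilsr 1 1)) Rsr_closed; case: f; vm_compute.
Qed.

(** * Equations of the variety *)

Lemma V_sat A e : calV A -> sat (Rsr 1 2) e -> sat A e.
Proof. by move=> VA /VV_models; apply. Qed.

(** All squares are equal, so [o] can be written as a square and the laws of [nilsr] become
    identities. *)
Lemma sat_nilsr (A R : algebra) (oR : R) :
  nilsr oR -> (forall e, sat R e -> sat A e) -> exists o : A, nilsr o.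
Proof.
move=> nR RA.
pose x := Var 0; pose y := Var 1; pose z := Var 2.
have S s t : sat R (s, t) -> forall a b d : A,
    eval (fun n => nth a [:: a; b; d] n) s = eval (fun n => nth a [:: a; b; d] n) t.
  by move=> /RA + a b d; apply.
case: (Defs.nonempty A) => e; exists (e [*] e).
have sq a : a [*] a = e [*] e.
  apply: (S (Mul x x) (Mul y y) _ a e e) => v /=; by rewrite !(mul_sq nR).
split=> [a b|a b d|a|a b|a b d|a|a|//|a b d].
- by apply: (S (Add x y) (Add y x) _ a b b) => v; apply: (addC nR).
- by apply: (S (Add x (Add y z)) (Add (Add x y) z) _ a b d) => v; apply: (addA nR).
- by apply: (S (Add x x) x _ a a a) => v; apply: (addI nR).
- by apply: (S (Mul x y) (Mul y x) _ a b b) => v; apply: (mulC nR).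
- by apply: (S (Mul (Add x y) z) (Add (Mul x z) (Mul y z)) _ a b d) => v; apply: (mulDl nR).
- rewrite -(sq a); apply: (S (Add x (Mul x x)) (Mul x x) _ a a a) => v /=.
  by rewrite (mul_sq nR) (add_top nR).
- rewrite -(sq a); apply: (S (Mul (Mul x x) x) (Mul x x) _ a a a) => v /=.
  by rewrite (mul_sq nR) (mul_top nR).
- rewrite -(sq a); apply: (S (Mul (Mul x y) z) (Mul x x) _ a b d) => v /=.
  by rewrite (mul3 nR) (mul_sq nR).
Qed.

Lemma V_nilsr (A : algebra) : calV A -> exists o : A, nilsr o.
Proof. by move=> VA; apply: (sat_nilsr (Rsr_nilsr 1 2)) => e; apply: V_sat. Qed.

(* The boolean is the parity of the length, [true] for odd walks. *)
Inductive walk (t : term) (x : nat) : bool -> nat -> Prop :=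
  | walk0 : walk t x false x
  | walkS b y z : walk t x b y -> edg t y z -> walk t x (~~ b) z.

Lemma walk_trans t x y z b b' :
  walk t x b y -> walk t y b' z -> walk t x (b (+) b') z.
Proof.
move=> xy; elim=> [|b'' u w _ IH uw]; first by rewrite addbF.
by rewrite addbN; apply: walkS IH uw.
Qed.

Lemma walk_sym t x y b : walk t x b y -> walk t y b x.
Proof.
elim=> [|b' u w _ IH uw]; first exact: walk0.
exact: (walk_trans (walkS (walk0 t w) (edg_sym uw)) IH).
Qed.

Definition bipartite t := forall x, ~ walk t x true x.

Lemma bipartite_walk t x y : bipartite t -> walk t x true y -> ~ walk t x false y.
Proof. by move=> bt xy /walk_sym yx; apply: (bt x); apply: walk_trans xy yx. Qed.

Lemma R12_prod (x y : Rsr 1 2) :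
  @le (Rsr 1 2) (x [*] y) mc -> x [*] y = mc.
Proof. by rewrite /le /= addM_E; case: x; case: y. Qed.

Definition sideM (x : M) : bool := match x with mp | ma => false | _ => true end.

Lemma R12_walk (g : nat -> Rsr 1 2) t x y b :
  @le (Rsr 1 2) (eval g t) mc -> walk t x b y -> sideM (g y) = b (+) sideM (g x).
Proof.
move=> /(eval_le (Rsr_nilsr 1 2)) H; elim=> [//|b' u w _ IH uw].
have /R12_prod := H (W2 u w) uw.
by rewrite addNb -IH; case: (g u); case: (g w).
Qed.

Lemma R12_edge (g : nat -> Rsr 1 2) t x y :
  edg t x y -> @le (Rsr 1 2) (eval g t) mc \/ eval g t = m0.
Proof.
move=> /(@occurs_le _ _ (Rsr_nilsr 1 2) g t (W2 x y)) /=.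
rewrite /le /= addM_E; case: (eval g t); case: (g x); case: (g y) => //=; auto.
Qed.

Lemma walk_odd_edge t x y : walk t x true y -> exists z, edg t x z.
Proof.
have H b z : walk t x b z -> b = false /\ z = x \/ exists z, edg t x z.
  elim=> [|b' u w _ [[_ ->] xw|]]; by [left|right; exists w|right].
by case/H => [[]|].
Qed.

Section Variety.
Variables (A : algebra) (o : A).
Hypotheses (VA : calV A) (nA : nilsr o).

(** In [Rsr 1 2] a value below [mc] would make [sideM] a two-colouring of the odd closed walk. Thus
    [t] agrees there with a square, and this identity passes to [A]. *)
Lemma V_odd t (g : nat -> A) : ~ bipartite t -> eval g t = o.
Proof.
move=> /existsNP[x]; rewrite not_notP => xx.
have := V_sat (e := (t, Mul (Var 0) (Var 0))) VA.
rewrite /sat /= => -> //; first by rewrite (mul_sq nA).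
move=> v; have [z xz] := walk_odd_edge xx.
have [H|->] := R12_edge v xz; last by case: (v 0).
by have := R12_walk H xx; case: sideM.
Qed.

(* Both [x] and [y] avoid [mp] when they are marked, so they are adjacent as
   soon as they lie on different sides. *)
Lemma V_marked t (g : nat -> A) x y :
  lin t x -> lin t y -> walk t x true y -> g x [*] g y [<=] eval g t.
Proof.
move=> tx ty xy; apply: (V_sat (e := preceq (Mul (Var x) (Var y)) t) VA) => v.
change (@le (Rsr 1 2) (v x [*] v y) (eval v t)).
have [z xz] := walk_odd_edge xy.
have [H|->] := R12_edge v xz; last exact: (le_top (Rsr_nilsr 1 2)).
have side := R12_walk H xy; have nR := Rsr_nilsr 1 2.
have /(eval_le nR) Hw := H.
have xc := Hw (W1 x) tx; have yc := Hw (W1 y) ty.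
have /R12_prod xz1 := Hw (W2 x z) xz.
have [w yw] := walk_odd_edge (walk_sym xy).
have /R12_prod yw1 := Hw (W2 y w) yw.
suff -> : v x [*] v y = v x [*] v z by exact: (occurs_le nR v (w := W2 x z) xz).
move: xz1 yw1 xc yc side; rewrite /le /= addM_E.
by case: (v x); case: (v z) => // _; case: (v y); case: (v w).
Qed.

End Variety.

(** * Reduction of an identity to the seven *)

Lemma link_sym long x y : link long x y = link long y x.
Proof. by case: x; case: y. Qed.

Lemma link_mul long x y : link long x y -> mulG long x y = gc.
Proof. by case: x; case: y => //; case: long. Qed.

Definition ghom (t : term) (long : bool) (S : pred gel) (f : nat -> gel) : Prop :=
  (forall z, lin t z -> S (f z)) /\
  (forall z w, edg t z w -> link long (f z) (f w)).

Lemma G_P_ghom t f : ~ bad t -> ghom t true marksP f -> @le G_P (eval (f : nat -> G_P) t) gc.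
Proof.
move=> nb [fl fe]; apply/(eval_le G_P_nilsr) => -[z|z w|//] /=.
  by move=> /fl; rewrite /le; case: (f z).
move=> /fe /link_mul E; rewrite E; exact: (le_refl G_P_nilsr).
Qed.

Definition dominated (A : algebra) (x y : nat) (t : term) : Prop :=
  forall g : nat -> A, g x [*] g y [<=] eval g t.

Lemma dominated_sym (A : algebra) (o : A) x y t :
  nilsr o -> dominated A x y t -> dominated A y x t.
Proof. by move=> nA H g; rewrite (mulC nA). Qed.

(** Sending [v1] to [v4] to [a] to [d] turns [f] into a valuation that keeps [t] below [T];
    domination then bounds [ad]. *)
Lemma closed_of_ghom (A : algebra) (o : A) l t f x y :
  nilsr o -> ~ bad t -> ghom t false (marks_of l) f -> f x = v1 -> f y = v4 ->
  dominated A x y t -> closed A (pattern l).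
Proof.
move=> nA nb [fl fe] fx fy; rewrite /marks_of in fl.
case: (pattern l) fl => [[[ka kb] kc] kD] fl H T a b c d u v Ha Hb Hc ab bc cd HD.
(* Without [D] the path [ve] - [vf] - [vg] is folded onto the edge [bc]. *)
pose h z := match z with
  | v1 => a | v2 => b | v3 => c | v4 => d
  | vf => if kD then v else b
  | _ => if kD then u else c end.
have := H (h \o f); rewrite /= fx fy /= => /(le_trans nA); apply.
apply/(eval_le nA) => -[z|z w|//] /=.
  move=> /fl; case: (f z) => //=; try by auto.
  - by move=> k; move: HD; rewrite k => /(_ isT)[].
  - by move=> k; move: HD; rewrite k => /(_ isT)[].
have C := mulC nA.
have uv : (if kD then u else c) [*] (if kD then v else b) [<=] T.
  by case: (kD) HD => [/(_ isT)[]|_] //; rewrite C.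
by move=> /fe; case: (f z); case: (f w) => //= _; rewrite // C.
Qed.

Section Graph.
Variable t : term.
Hypotheses (nb : ~ bad t) (bt : bipartite t).

(* A product of two marked variables lies below [t] in the variety, so this
   is the case where [D(t,u)] can be mapped into [t]. *)
Definition marked_edge : Prop :=
  exists u v, [/\ lin t u, lin t v & walk t u true v].

Definition linked x y : Prop := exists b, walk t x b y.

(** Each component gets a root, marked if possible, and [true] means joined to the root by an even
    walk. Without a marked edge, all marked vertices of a component lie on the side of its root. *)
Lemma colouring : exists k : nat -> bool,
  (forall z w, edg t z w -> k w = ~~ k z) /\
  (marked_edge \/ forall z, lin t z -> k z).
Proof.
(* The admissible roots for [z]; the set depends only on the component, hence so does the choice
   [r z]. *)
pose C z := [set w | linked z w /\ (lin t w \/ forall u, linked z u -> ~ lin t u)].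
pose r z := xget 0 (C z).
have rP z : C z (r z).
  rewrite /r; apply: xgetPex.
  have [[u [zu tu]]|H] := pselect (exists u, linked z u /\ lin t u).
    by exists u; split=> //; left.
  exists z; split; first by exists false; apply: walk0.
  by right=> u zu tu; apply: H; exists u.
have rE z w : edg t z w -> r z = r w.
  move=> zw; rewrite /r; congr xget; apply: funext => v; apply: propext.
  have E v' : linked z v' <-> linked w v'.
    split=> -[b vb]; exists (true (+) b); apply: walk_trans vb.
      exact: (walkS (walk0 t w) (edg_sym zw)).
    exact: (walkS (walk0 t z) zw).
  rewrite /C /= E; split=> -[wv [tv|H]]; split=> //; try by left.
    by right=> u /E /H.
  by right=> u /E /H.
exists (fun z => `[<walk t (r z) false z>]); split=> [z w zw|].
  rewrite -(rE _ _ zw); have [[b zr] _] := rP z; have rz := walk_sym zr.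
  have rw := walkS rz zw; case: b {zr} rz rw => /= rz rw.
    by rewrite (asboolT rw) asboolF //; apply: bipartite_walk.
  by rewrite (asboolT rz) asboolF //; apply: bipartite_walk.
have [D|D] := pselect marked_edge; [by left|right=> z tz; apply/asboolP].
have [[b zr] [tr|H]] := rP z; last first.
  by case: (H z) => //; exists false; apply: walk0.
by case: b zr => zr; [case: D; exists z, (r z)|exact: walk_sym].
Qed.

(** * Maps of the graph onto short paths *)

Section Shape.
Variables (x y : nat).
Hypotheses (xy : walk t x true y) (exy : ~ edg t x y).

(** [P] and [Q] act on the two sides of the component of [x], disjoint by bipartiteness; the other
    components are coloured by [k] and folded onto the edge given by [K]. *)
Lemma ghom_shape long (S : pred gel) (P Q : nat -> gel) (K : bool -> gel) (k : nat -> bool) :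
  (forall z w, edg t z w -> k w = ~~ k z) ->
  (forall z w, walk t x false z -> edg t z w -> link long (P z) (Q w)) ->
  (forall b, link long (K b) (K (~~ b))) ->
  (forall z, walk t x false z -> lin t z -> S (P z)) ->
  (forall z, walk t x true z -> lin t z -> S (Q z)) ->
  (forall z, lin t z -> S (K (k z))) ->
  exists f, [/\ ghom t long S f, forall z, walk t x false z -> f z = P z
    & forall z, walk t x true z -> f z = Q z].
Proof.
move=> Hk HPQ HK SP SQ SK.
pose f z := if `[<walk t x false z>] then P z
  else if `[<walk t x true z>] then Q z else K (k z).
have fP z : walk t x false z -> f z = P z by move=> xz; rewrite /f asboolT.
have fQ z : walk t x true z -> f z = Q z.
  move=> xz; rewrite /f (asboolT xz) asboolF //; exact: bipartite_walk.
exists f; split=> //; split=> [z tz|z w zw].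
  by rewrite /f; case: asboolP => [|_]; [auto|case: asboolP; auto].
have wz := edg_sym zw.
have [xz|nz] := pselect (walk t x false z).
  by rewrite (fP _ xz) (fQ w) ?HPQ //; apply: walkS xz zw.
have [xz'|nz'] := pselect (walk t x true z).
  have xw : walk t x false w by apply: walkS xz' zw.
  by rewrite (fQ _ xz') (fP _ xw) link_sym; apply: HPQ.
have nw : ~ walk t x false w by move=> xw; apply: nz'; apply: walkS xw wz.
have nw' : ~ walk t x true w by move=> xw; apply: nz; apply: walkS xw wz.
by rewrite /f !asboolF // (Hk _ _ zw).
Qed.

End Shape.

(** * Identities forced by a dominated pair *)

Section Consequences.
Variables (A : algebra) (o : A).
Hypothesis nA : nilsr o.
Variables (x y : nat).
Hypotheses (xy : walk t x true y) (exy : ~ edg t x y).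
Hypothesis H : dominated A x y t.

Let xx := walk0 t x.

(** Only [x] goes to [v1] and the rest of its side to [v3]; only [y] goes to [v4] and the rest of
    its side to [v2]. The one missing link [v1] - [v4] would come from the edge [xy], which is
    absent. *)
Lemma dominated_ends l (K : bool -> gel) (k : nat -> bool) :
  (forall z w, edg t z w -> k w = ~~ k z) ->
  (forall b, link false (K b) (K (~~ b))) ->
  (forall z, lin t z -> marks_of l (K (k z))) ->
  (lin t x -> marks_of l v1) -> ~ lin t y ->
  (forall z, walk t x false z -> lin t z -> z <> x -> marks_of l v3) ->
  marks_of l v2 ->
  closed A (pattern l).
Proof.
move=> kP KP SK Sx ny S3 S2.
have [|||f [fh fP fQ]] := @ghom_shape x false (marks_of l)
  (fun z => if z == x then v1 else v3) (fun z => if z == y then v4 else v2) K k kP _ KP _ _ SK.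
- move=> z w _; case: eqP => [->|_]; case: eqP => [->|_] //.
- by move=> z xz tz; case: eqP tz => [->|zx tz]; [|apply: (S3 z)].
- by move=> z _ tz; case: eqP tz => [->|].
apply: (closed_of_ghom nA nb fh _ _ H); first by rewrite fP // eqxx.
by rewrite fQ // eqxx.
Qed.

Lemma dominated_eps : ~ lin t y -> closed A (pattern eps).
Proof.
move=> ny; have [k [kP _]] := colouring.
by apply: (@dominated_ends eps (fun b => if b then v1 else v2) k) => //;
  [case|move=> z _; case: (k z)].
Qed.

Lemma dominated_mu2 : ~ lin t x -> ~ lin t y -> closed A (pattern mu2).
Proof.
move=> nx ny; have [k [kP _]] := colouring.
by apply: (@dominated_ends mu2 (fun b => if b then v3 else v2) k) => //;
  [case|move=> z _; case: (k z)].
Qed.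

(** With a marked edge, [D] absorbs the other components. Otherwise the colouring lets every marked
    vertex go to [v2]. *)
Lemma dominated_mu :
  (forall z, walk t x false z -> ~ lin t z) -> ~ lin t y ->
  closed A (pattern (if `[<marked_edge>] then muD else mu)).
Proof.
move=> nx ny; have [k [kP kD]] := colouring.
case: asboolP => D.
  by apply: (@dominated_ends muD (fun b => if b then ve else vf) k) => //;
  [case|move=> z _; case: (k z)|move=> /(nx x (walk0 t x))|move=> z /nx nz /nz].
case: kD => // kt.
by apply: (@dominated_ends mu (fun b => if b then v2 else v3) k) => //;
  [case|move=> z /kt ->|move=> /(nx x (walk0 t x))|move=> z /nx nz /nz].
Qed.

(** The path is read backwards, with [y] at [v1] and [x] at [v4], so that the marked side of the
    component lands on [v1] and [v3]. *)
Lemma dominated_gamma :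
  (forall z, walk t x false z -> ~ lin t z) ->
  closed A (pattern (if `[<marked_edge>] then gamma1D else gamma1)).
Proof.
move=> nx; have [k [kP kD]] := colouring.
pose l := if `[<marked_edge>] then gamma1D else gamma1; rewrite -/l.
pose K b := if `[<marked_edge>] then (if b then ve else vf) else (if b then v3 else v2).
have [|||||f [fh fP fQ]] := @ghom_shape x false (marks_of l)
  (fun z => if z == x then v4 else v2) (fun z => if z == y then v1 else v3) K k kP.
- by move=> z w _; case: eqP => [->|_]; case: eqP => [->|_].
- by rewrite /K; case: asboolP => _ [].
- by move=> z /nx.
- by move=> z _ _; rewrite /l; case: eqP; case: asboolP.
- move=> z tz; rewrite /l /K; case: asboolP => D; first by case: (k z).
  by case: kD => // /(_ _ tz) ->.
apply: (closed_of_ghom nA nb fh _ _ (dominated_sym nA H)).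
  by rewrite fQ // eqxx.
by rewrite fP // eqxx.
Qed.

(** [y] and the marked vertices of its side go to [v1], the others of that side to [v3]. This fits
    [x] at [v4] because [x] has no marked neighbour. *)
Lemma dominated_kappa :
  ~ lin t x -> (forall z, lin t z -> ~ edg t x z) -> closed A (pattern kappa).
Proof.
move=> nx nN; have [k [kP kD]] := colouring.
have [|||||f [fh fP fQ]] := @ghom_shape x false (marks_of kappa)
  (fun z => if z == x then v4 else v2)
  (fun z => if (z == y) || `[<lin t z>] then v1 else v3)
  (fun b => if b then v1 else v2) k kP.
- move=> z w _ zw; case: eqP zw => [-> xw|_ _]; last by case: ifP.
  by case: ifP => // /orP[/eqP E|/asboolP /nN //]; case: exy; rewrite -E.
- by case.
- by move=> z _ tz; case: eqP tz => [->|].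
- by move=> z _ tz; rewrite (asboolT tz) orbT.
- by move=> z _; case: (k z).
apply: (closed_of_ghom nA nb fh _ _ (dominated_sym nA H)).
  by rewrite fQ // eqxx.
by rewrite fP // eqxx.
Qed.

End Consequences.

(** The ends of even walks from [x] whose vertices at odd positions are marked; along such walks
    [mu] pulls an edge back to [x]. *)
Inductive chain (x : nat) : nat -> Prop :=
  | chain0 : chain x x
  | chainS z v z' : chain x z -> edg t z v -> lin t v -> edg t v z' -> chain x z'.

(** * Products derived from the identities *)

Section Derivations.
Variables (A : algebra) (o : A).
Hypotheses (VA : calV A) (nA : nilsr o).
Variables (g : nat -> A).

Let T := eval g t.
Let C := mulC nA.

Let lin_le z : lin t z -> g z [<=] T.
Proof. exact: (occurs_le nA g (w := W1 z)). Qed.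

Let edg_le z w : edg t z w -> g z [*] g w [<=] T.
Proof. exact: (occurs_le nA g (w := W2 z w)). Qed.

Let marked_le z w : lin t z -> lin t w -> walk t z true w -> g z [*] g w [<=] T.
Proof. exact: (V_marked VA). Qed.

Let some_marked_edge : marked_edge ->
  exists a b : A, [/\ a [<=] T, b [<=] T & a [*] b [<=] T].
Proof. by case=> u [v [tu tv uv]]; exists (g u), (g v); split; auto. Qed.

(** The path [z], [v], [z'], [y] with [v] marked yields the bound on [zy] from the one on [z'y]. *)
Lemma chain_mu x z y :
  closed A (pattern (if `[<marked_edge>] then muD else mu)) ->
  chain x z -> edg t z y -> g x [*] g y [<=] T.
Proof.
move=> cl xz /edg_le; elim: xz => [//|{}z v z' _ IH zv tv vz' z'y]; apply: IH.
case: asboolP cl => [/some_marked_edge [a [b [aT bT abT]]]|_] cl.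
  by apply: (cl T (g z) (g v) (g z') (g y) a b); auto.
by apply: (cl T (g z) (g v) (g z') (g y) (g z) (g z)); auto.
Qed.

(** The same step on the reversed path [y], [z'], [v], [z], in which [y] and [v] are marked. *)
Lemma chain_gamma x z y :
  closed A (pattern (if `[<marked_edge>] then gamma1D else gamma1)) -> lin t y ->
  chain x z -> edg t z y -> g x [*] g y [<=] T.
Proof.
move=> cl ty xz /edg_le; elim: xz => [//|{}z v z' _ IH zv tv vz' z'y]; apply: IH.
have yz' : g y [*] g z' [<=] T by rewrite C.
have z'v := edg_le (edg_sym vz'); have vz := edg_le (edg_sym zv).
rewrite C; case: asboolP cl => [/some_marked_edge [a [b [aT bT abT]]]|_] cl.
  by apply: (cl T (g y) (g z') (g v) (g z) a b); auto.
by apply: (cl T (g y) (g z') (g v) (g z) (g z) (g z)); auto.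
Qed.

Variables (x y p q : nat).
Hypotheses (xy : walk t x true y) (tp : lin t p) (tq : lin t q).
Hypotheses (xp : walk t x false p) (xq : walk t x true q).

Let pq_le : g p [*] g q [<=] T.
Proof. by apply: marked_le => //; apply: (walk_trans (walk_sym xp) xq). Qed.

Let qp_le : g q [*] g p [<=] T.
Proof. by rewrite C. Qed.

(** Along the walk, [kappa] is applied with [p] and [q], in alternating order, as [a] and [b] and
    with the next edge of the walk as [cd]. *)
Lemma derive_kappa b z : closed A (pattern kappa) -> walk t x b z ->
  (if b then g p else g q) [*] g z [<=] T.
Proof.
move=> cl xz; have {xz} : walk t p b z by exact: (walk_trans (walk_sym xp) xz).
elim=> [//|b' u w _ IH uw].
by case: b' IH => /= IH; [apply: (cl T (g q) (g p) (g u) (g w) T T)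
  |apply: (cl T (g p) (g q) (g u) (g w) T T)]; auto.
Qed.

(** [eps] is applied to the path [x], [q], [p'], [y]. Its first three vertices are marked, so its
    first two edges come from [marked_le]. *)
Lemma derive_eps p' : closed A (pattern eps) -> lin t x -> lin t p' -> edg t p' y ->
  g x [*] g y [<=] T.
Proof.
move=> cl tx tp' p'y.
have qp' : walk t q true p'.
  exact: (walk_trans (walk_sym xq) (walkS xy (edg_sym p'y))).
by apply: (cl T (g x) (g q) (g p') (g y) T T); auto.
Qed.

Lemma derive_mu2 : closed A (pattern mu2) ->
  g x [*] g q [<=] T -> g p [*] g y [<=] T -> g x [*] g y [<=] T.
Proof.
by move=> cl xqT pyT; apply: (cl T (g x) (g q) (g p) (g y) T T); auto.
Qed.

End Derivations.

(** * Classification of the dominated pairs *)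

Definition reduces (E : seq label) (x y : nat) : Prop :=
  forall A, calV A ->
    dominated A x y t <-> forall l, l \in E -> closed A (pattern l).

Lemma reduces_sym E x y : reduces E x y -> reduces E y x.
Proof.
move=> H A VA; have [o nA] := V_nilsr VA; rewrite -(H A VA).
by split; apply: (dominated_sym nA).
Qed.

Section OddPair.
Variables (x y : nat).
Hypotheses (xy : walk t x true y) (exy : ~ edg t x y).

(** On the side of [x], vertices reached by a chain go to [v4], the others to [v2]. On the other
    side [y] goes to [v1], a further marked vertex to [v5] or [v1] according to whether it has a
    reached neighbour, an unmarked one to [v3]. Then the images of [x] and [y] are not linked. *)
Lemma refute_chain :
  (forall z, walk t x false z -> ~ lin t z) ->
  (forall z, chain x z -> ~ edg t z y) -> ~ dominated G_P x y t.
Proof.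
move=> nx nc H; have [k [kP _]] := colouring.
pose R z := exists2 w, chain x w & edg t w z.
have [|||||f [fh fP fQ]] := @ghom_shape x true marksP
  (fun z => if `[<chain x z>] then v4 else v2)
  (fun z => if z == y then v1 else if `[<lin t z>] then
     (if `[<R z>] then v5 else v1) else v3)
  (fun b => if b then ve else vf) k kP.
- move=> z w xz zw; case: (asboolP (chain x z)) => cz.
    case: eqP => [E|_]; first by case: (nc z cz); rewrite -E.
    by case: asboolP => // _; rewrite asboolT //; exists z.
  case: eqP => // _; case: asboolP => // tw; rewrite asboolF // => -[v cv vw].
  by apply: cz; apply: chainS cv vw tw (edg_sym zw).
- by case.
- by move=> z /nx.
- by move=> z _ tz; rewrite (asboolT tz); case: ifP => // _; case: ifP.
- by move=> z _; case: (k z).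
have := le_trans G_P_nilsr (H f) (G_P_ghom nb fh).
rewrite (fP x (walk0 t x)) (fQ y xy) eqxx asboolT; last exact: chain0.
by vm_compute.
Qed.

Lemma one_sided :
  (forall z, walk t x false z -> ~ lin t z) -> dominated G_P x y t ->
  exists E, reduces E x y.
Proof.
move=> nx H; have [[z [xz zy]]|nc] := pselect (exists z, chain x z /\ edg t z y);
  last by case: (refute_chain nx _ H) => z xz zy; apply: nc; exists z.
have [ty|ny] := pselect (lin t y).
  exists [:: if `[<marked_edge>] then gamma1D else gamma1] => A VA.
  have [o nA] := V_nilsr VA; split=> [D l|D g]; rewrite ?inE.
    by move=> /eqP ->; apply: (dominated_gamma nA xy exy D nx).
  by apply: (chain_gamma VA nA g (D _ _) ty xz zy); rewrite inE.
exists [:: if `[<marked_edge>] then muD else mu] => A VA.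
have [o nA] := V_nilsr VA; split=> [D l|D g]; rewrite ?inE.
  by move=> /eqP ->; apply: (dominated_mu nA xy exy D nx).
by apply: (chain_mu VA nA g (D _ _) xz zy); rewrite inE.
Qed.

(** For [x] marked, [E] is [eps] if [y] has a marked neighbour and [kappa] otherwise. For [x]
    unmarked, it is [mu2] if both have marked neighbours, and [kappa] with [mu2] otherwise. *)
Lemma two_sided p q : ~ lin t y -> lin t p -> lin t q ->
  walk t x false p -> walk t x true q -> exists E, reduces E x y.
Proof.
move=> ny tp tq xp xq.
have yx := walk_sym xy; have eyx : ~ edg t y x by move=> /edg_sym.
have [[p' [tp' p'y]]|nNy] := pselect (exists p', lin t p' /\ edg t p' y);
have [tx|nx] := pselect (lin t x).
- exists [:: eps] => A VA; have [o nA] := V_nilsr VA; split=> [D l|D g].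
    by rewrite inE => /eqP ->; apply: (dominated_eps nA xy exy D).
  by apply: (derive_eps VA nA g xy tq xq (D _ _) tx tp' p'y); rewrite inE.
- have xp' : walk t x false p' by exact: (walkS xy (edg_sym p'y)).
  have [[q' [tq' q'x]]|nNx] := pselect (exists q', lin t q' /\ edg t q' x).
    have xq' : walk t x true q' by exact: (walkS (walk0 t x) (edg_sym q'x)).
    exists [:: mu2] => A VA; have [o nA] := V_nilsr VA; split=> [D l|D g].
      by rewrite inE => /eqP ->; apply: (dominated_mu2 nA xy exy D).
    apply: (derive_mu2 VA nA tp' tq' xp' xq' (D _ _)); first by rewrite inE.
      by rewrite (mulC nA); apply: (occurs_le nA g (w := W2 q' x)).
    exact: (occurs_le nA g (w := W2 p' y)).
  exists [:: kappa; mu2] => A VA; have [o nA] := V_nilsr VA; split=> [D l|D g].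
    rewrite !inE => /orP[] /eqP ->; last exact: (dominated_mu2 nA xy exy D).
    apply: (dominated_kappa nA xy exy D nx) => z tz xz.
    by apply: nNx; exists z; split=> //; apply: edg_sym.
  have Dk : closed A (pattern kappa) by apply: D; rewrite inE.
  apply: (derive_mu2 VA nA tp tq xp xq); first by apply: D; rewrite !inE.
    rewrite (mulC nA).
    exact: (derive_kappa VA nA g tp tq xp xq Dk (walk0 t x)).
  exact: (derive_kappa VA nA g tp tq xp xq Dk xy).
- exists [:: kappa] => A VA; have [o nA] := V_nilsr VA; split=> [D l|D g].
    rewrite inE => /eqP ->.
    apply: (dominated_kappa nA yx eyx (dominated_sym nA D) ny) => z tz yz.
    by apply: nNy; exists z; split=> //; apply: edg_sym.
  have Dk : closed A (pattern kappa) by apply: D; rewrite inE.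
  exact: (derive_kappa VA nA g tx tq (walk0 t x) xq Dk xy).
- exists [:: kappa; mu2] => A VA; have [o nA] := V_nilsr VA; split=> [D l|D g].
    rewrite !inE => /orP[] /eqP ->; last exact: (dominated_mu2 nA xy exy D).
    apply: (dominated_kappa nA yx eyx (dominated_sym nA D) ny) => z tz yz.
    by apply: nNy; exists z; split=> //; apply: edg_sym.
  have Dk : closed A (pattern kappa) by apply: D; rewrite inE.
  apply: (derive_mu2 VA nA tp tq xp xq); first by apply: D; rewrite !inE.
    rewrite (mulC nA).
    exact: (derive_kappa VA nA g tp tq xp xq Dk (walk0 t x)).
  exact: (derive_kappa VA nA g tp tq xp xq Dk xy).
Qed.

End OddPair.

Lemma odd_pair x y : walk t x true y -> ~ edg t x y -> dominated G_P x y t ->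
  exists E, reduces E x y.
Proof.
move=> xy exy H.
have yx := walk_sym xy; have eyx : ~ edg t y x by move=> /edg_sym.
have [[p [tp xp]]|np] := pselect (exists p, lin t p /\ walk t x false p);
  last by apply: one_sided => // z xz tz; apply: np; exists z.
have [[q [tq xq]]|nq] := pselect (exists q, lin t q /\ walk t x true q); last first.
  have [E RE] : exists E, reduces E y x.
    apply: (one_sided yx eyx _ (dominated_sym G_P_nilsr H)) => z yz tz.
    by apply: nq; exists z; split=> //; apply: (walk_trans xy yz).
  by exists E; apply: reduces_sym.
have [ty|ny] := pselect (lin t y); last exact: (two_sided xy exy ny tp tq xp xq).
have [tx|nx] := pselect (lin t x).
  exists [::] => A VA; split=> // _ g; exact: (V_marked VA).
have [E RE] : exists E, reduces E y x.
  by apply: (two_sided yx eyx nx tq tp); [apply: (walk_trans yx xq)|apply: (walk_trans yx xp)].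
by exists E; apply: reduces_sym.
Qed.

Lemma walk_colour (k : nat -> bool) x y b :
  (forall z w, edg t z w -> k w = ~~ k z) -> walk t x b y -> k y = b (+) k x.
Proof.
move=> kP; elim=> [//|b' u w _ IH uw]; by rewrite (kP _ _ uw) IH addNb.
Qed.

(** Without an odd walk a two-colouring can be adjusted by components to give [x] and [y] the same
    colour. Folding onto [ve] - [vf] sends both to [ve], whose square is [g0]. *)
Lemma even_pair x y : ~ walk t x true y -> ~ dominated G_P x y t.
Proof.
move=> nxy H; have [k [kP _]] := colouring.
pose k' z := k z (+) (if `[<linked x z>] then k x else k y).
have k'P z w : edg t z w -> k' w = ~~ k' z.
  move=> zw; rewrite /k' (kP _ _ zw) addNb.
  have -> // : `[<linked x z>] = `[<linked x w>].
  apply: asbool_equiv_eq; split=> -[b xb]; exists (~~ b); apply: walkS xb _ => //.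
  exact: edg_sym.
have fh : ghom t true marksP (fun z => if k' z then vf else ve).
  split=> [z _|z w /k'P ->]; first by case: ifP.
  by case: (k' z).
have := le_trans G_P_nilsr (H _) (G_P_ghom nb fh).
have -> : k' x = false by rewrite /k' asboolT ?addbb //; exists false; apply: walk0.
have -> : k' y = false.
  rewrite /k'; case: asboolP => [[[] xb]|_]; rewrite ?addbb //.
  by rewrite (walk_colour kP xb) addbb.
by vm_compute.
Qed.

(** [vg] is an unmarked twin of [ve]: [x] alone is sent there, and the rest is folded onto [ve] -
    [vf]. *)
Lemma refute_var x : ~ lin t x -> exists f : nat -> G_P,
  @le G_P (eval (f : nat -> G_P) t) gc /\ ~ @le G_P (f x) gc.
Proof.
move=> nx; have [k [kP _]] := colouring.
exists (fun z => if z == x then vg else if k z == k x then ve else vf).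
split; last by rewrite eqxx; vm_compute.
apply: (G_P_ghom nb); split=> [z tz|z w /kP E].
  by case: eqP tz => [->|_ _]; last case: ifP.
have zx : (z == x) -> k z == k x by move=> /eqP ->.
have wx : (w == x) -> k w == k x by move=> /eqP ->.
move: zx wx; rewrite E; case: (z == x) => [/(_ isT)/eqP ->|_].
  by case: (w == x) => [/(_ isT)|_]; case: (k x).
by case: (w == x) => [/(_ isT)|_]; case: (k z); case: (k x).
Qed.

Lemma refute_zero : exists f : nat -> G_P, @le G_P (eval (f : nat -> G_P) t) gc.
Proof.
have [k [kP _]] := colouring; exists (fun z => if k z then ve else vf).
apply: (G_P_ghom nb); split=> [z _|z w /kP ->]; first by case: ifP.
by case: (k z).
Qed.

End Graph.

Definition wterm (w : word) : term :=
  match w with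
  | W1 x => Var x | W2 x y => Mul (Var x) (Var y) | W0 => Mul (Var 0) (Var 0)
  end.

Lemma eval_wterm (A : algebra) (o : A) g w :
  nilsr o -> eval g (wterm w) = wval o g w.
Proof. by case: w => //= nA; rewrite (mul_sq nA). Qed.

Lemma closed_labels (A : algebra) (o : A) (E : seq label) : nilsr o ->
  (forall l, l \in E -> closed A (pattern l)) <->
  (forall l, l \in E -> sat A (ident l)).
Proof.
by move=> nA; split=> H l lE; [apply/(sat_closed _ nA)|apply/(sat_closed l nA)]; apply: H.
Qed.

(** Inequalities valid throughout [calV] take the empty [E]. Among the others, the test in [G_P]
    leaves only products of two variables joined by an odd walk. *)
Theorem reduction w t : sat G_P (preceq (wterm w) t) ->
  exists E : seq label, forall A, calV A ->
    sat A (preceq (wterm w) t) <-> forall l, l \in E -> sat A (ident l).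
Proof.
move=> H.
have trivial : (forall (A : algebra) (o : A), calV A -> nilsr o ->
      forall g : nat -> A, wval o g w [<=] eval g t) ->
    exists E : seq label, forall A, calV A ->
    sat A (preceq (wterm w) t) <-> forall l, l \in E -> sat A (ident l).
  move=> K; exists [::] => A VA; split=> // _; have [o nA] := V_nilsr VA.
  by apply/sat_preceq => g; rewrite (eval_wterm _ _ nA); apply: K.
have [tw|ntw] := pselect (occurs t w).
  by apply: trivial => A o VA nA g; apply: occurs_le.
have [tb|nb] := pselect (bad t).
  apply: trivial => A o VA nA g.
  by apply: (le_trans nA (le_top nA _)); apply: (occurs_le nA g (w := W0)).
have [bt|nbt] := pselect (bipartite t); last first.
  by apply: trivial => A o VA nA g; rewrite (V_odd VA nA _ nbt); apply: le_top.
case: w H ntw {trivial} => [x|x y|] /= H ntw.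
- have [f [ft]] := refute_var nb bt ntw; case.
  exact: (le_trans G_P_nilsr (H f) ft).
- have [xy|nxy] := pselect (walk t x true y); last by case: (even_pair nb bt nxy H).
  have [E RE] := odd_pair nb bt xy ntw H; exists E => A VA.
  have [o nA] := V_nilsr VA.
  by rewrite -(closed_labels _ nA) -RE.
- have [f ft] := refute_zero nb bt.
  have : @le G_P (eval (f : nat -> G_P) (wterm W0)) gc.
    exact: (le_trans G_P_nilsr (H f) ft).
  by rewrite (eval_wterm _ _ G_P_nilsr).
Qed.

(** * The interval *)

(** An identity of [W] splits into inequalities between a word and a term. Each holds in [G_P], so
    over [calV] it is equivalent to a set of labels, and these pass from [W] to [K]. *)
Theorem sub_of_labels (K W : set algebra) :
  is_variety W -> calP `<=` W -> W `<=` calV -> K `<=` calV ->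
  (forall l, models W (ident l) -> models K (ident l)) -> K `<=` W.
Proof.
move=> vW PW WV KV WK A KA; apply: Birkhoff => // -[s t] Wst g /=.
have VA := KV _ KA; have [o nA] := V_nilsr VA.
have half s' t' : models W (s', t') -> eval g s' [<=] eval g t'.
  move=> W'; apply/(eval_le nA) => w sw.
  have Ww : models W (preceq (wterm w) t').
    move=> B WB; have [oB nB] := V_nilsr (WV _ WB).
    apply/sat_preceq => h; rewrite (eval_wterm _ _ nB) -(W' B WB h).
    exact: occurs_le.
  have [E HE] := reduction (Ww _ (PW _ G_P_calP)).
  rewrite -(eval_wterm _ _ nA); apply: (proj1 (sat_preceq _ _ _) (proj2 (HE A VA) _)) => l lE.
  apply: (WK l) => // B WB; apply: (proj1 (HE B (WV _ WB))) lE; exact: Ww.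
by apply: (le_anti nA); apply: half => // B WB v; rewrite (Wst B WB v).
Qed.

Lemma calV_variety : is_variety calV.
Proof. exact: smallest_is_variety. Qed.

Lemma Vsub_variety E : is_variety (Vsub E).
Proof. exact: (adjoin_is_variety _ calV_variety). Qed.

Lemma Vsub_V E : Vsub E `<=` calV.
Proof. by move=> A []. Qed.

(** Every rule has a single premise, so the closure of [E] is the union of the closures of its
    elements. *)
Lemma rule_closureP (E : set label) f :
  rule_closure E f <-> exists2 e, E e & f \in consequences e.
Proof.
split=> [|[e Ee]].
  elim=> [{}f Ef|{}e {}f _ [e' Ee' ee'] ef].
    by exists f => //; case: f Ef.
  by exists e' => //; case: ef ee'; case: e' {Ee'}.
have C := @Defs.closure_rule E; have {Ee}Ee := Defs.closure_mem Ee.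
have R1 := C _ _ _ rule_gamma1D_eps; have R2 := C _ _ _ rule_gamma1_gamma1D.
have R3 := C _ _ _ rule_kappa_eps; have R5 := C _ _ _ rule_muD_gamma1D.
have R6 := C _ _ _ rule_muD_kappa; have R7 := C _ _ _ rule_muD_mu2.
have R4 := C _ _ _ rule_mu2_eps.
have R8 := C _ _ _ rule_mu_gamma1; have R9 := C _ _ _ rule_mu_muD.
by case: e Ee; case: f => // H _; auto 10.
Qed.

Lemma rule_models (K : set algebra) e f : K `<=` calV ->
  rule e f -> models K (ident e) -> models K (ident f).
Proof.
move=> KV ef H A KA; have [o nA] := V_nilsr (KV _ KA).
by apply/(sat_closed _ nA)/(rule_sound nA ef)/(sat_closed _ nA)/H.
Qed.

(** For completeness, [G_label f] is a countermodel: it satisfies every label that does not have [f]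
    among its consequences. *)
Theorem Vsub_models (E : set label) f :
  models (Vsub E) (ident f) <-> rule_closure E f.
Proof.
split=> [H|]; last first.
  elim=> [{}f Ef A [_]|e {}f _ IH ef]; first by apply; exists f.
  exact: (rule_models (@Vsub_V E) ef IH).
apply/not_notP => nEf.
have : sat (G_label f) (ident f).
  apply: H; split; first exact: G_label_V.
  move=> _ [e Ee <-]; apply/G_label_sat/negP => fe.
  by apply: nEf; apply/rule_closureP; exists e.
by move/G_label_sat; case: (f).
Qed.

Definition basis_of (k : nat) : seq label := (nth ([::], [::], [::]) node_table k).1.1.

Definition holds (k : nat) (l : label) : bool :=
  has (fun e => l \in consequences e) (basis_of k).

Lemma node_models (k : 'I_16) l : models (node k) (ident l) <-> holds k l.
Proof.
rewrite Vsub_models rule_closureP; split=> [[e Ee le]|/hasP[e Ee le]].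
  by apply/hasP; exists e.
by exists e.
Qed.

Lemma interval_sub W W' : vinterval calP calV W -> vinterval calP calV W' ->
  W `<=` W' <-> (forall l, models W' (ident l) -> models W (ident l)).
Proof.
move=> [vW [PW WV]] [vW' [PW' WV']]; split=> [WW' l H A /WW' /H //|].
exact: sub_of_labels.
Qed.

Lemma interval_eq W W' : vinterval calP calV W -> vinterval calP calV W' ->
  (forall l, models W (ident l) <-> models W' (ident l)) -> W = W'.
Proof.
move=> iW iW' H; apply/seteqP.
by split; apply/interval_sub => // l /H.
Qed.

Lemma calP_models l : models calP (ident l).
Proof. by apply/Vsub_models/rule_closureP; exists mu => //; case: l. Qed.

Lemma Vsub_interval E : vinterval calP calV (Vsub E).
Proof.
split; first exact: Vsub_variety.
split; last exact: Vsub_V.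
by move=> A PA; split=> [|_ [l _ <-]]; [case: PA|apply: calP_models].
Qed.

Definition sub_node (k l : nat) : bool :=
  all (fun x => holds l x ==> holds k x) labels.

Lemma all_labels (P : pred label) : all P labels -> forall l, P l.
Proof. by move=> /allP H l; apply: H; case: l. Qed.

Lemma node_sub (k l : 'I_16) : node k `<=` node l <-> sub_node k l.
Proof.
rewrite (interval_sub (Vsub_interval _) (Vsub_interval _)); split=> [H|/all_labels H x].
  by apply/allP => x _; apply/implyP => /node_models/H/node_models.
by move=> /node_models lx; apply/node_models; have /implyP := H x; apply.
Qed.

Lemma ord16 (P : nat -> bool) : all P (iota 0 16) -> forall k : 'I_16, P k.
Proof. by move=> /allP H k; apply: H; rewrite mem_iota ltn_ord. Qed.

Lemma node_inj : injective node.
Proof.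
move=> k l kl; apply/val_inj/eqP; move: (k) (l) kl => {k l} k l kl.
have kl1 : sub_node k l by apply/node_sub; rewrite kl.
have lk : sub_node l k by apply/node_sub; rewrite kl.
have H : all (fun k => all (fun l => sub_node k l && sub_node l k ==> (k == l))
  (iota 0 16)) (iota 0 16) by vm_compute.
by have /ord16/(_ l)/implyP := ord16 H k; apply; rewrite kl1.
Qed.

(** The labels valid in [W] are closed under the rules, and of the 128 truth vectors only those in
    the table are. *)
Lemma interval_node W : vinterval calP calV W -> exists k : 'I_16, W = node k.
Proof.
move=> iW; pose h l := `[< models W (ident l) >].
have hr e f : rule e f -> h e ==> h f.
  move=> ef; apply/implyP => /asboolP We; apply/asboolP.
  by apply: rule_models ef We; case: iW => _ [].
have [k Hk] : exists k : 'I_16, forall l, holds k l = h l.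
  have : has (fun k => all (fun l => holds k l == h l) labels) (iota 0 16).
    move: (hr _ _ rule_gamma1D_eps) (hr _ _ rule_gamma1_gamma1D)
      (hr _ _ rule_kappa_eps) (hr _ _ rule_mu2_eps) (hr _ _ rule_muD_gamma1D)
      (hr _ _ rule_muD_kappa) (hr _ _ rule_muD_mu2) (hr _ _ rule_mu_gamma1)
      (hr _ _ rule_mu_muD).
    rewrite /labels /=.
    by case: (h eps); case: (h gamma1D); case: (h gamma1); case: (h kappa);
      case: (h mu2); case: (h muD); case: (h mu).
  case/hasP => k; rewrite mem_iota => /andP[_ k16] /all_labels H.
  by exists (Ordinal k16) => l; apply/eqP/H.
exists k; apply: (interval_eq iW (Vsub_interval _)) => l.
by rewrite node_models Hk; apply: rwP; apply: asboolP.
Qed.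

Definition cover_node (k l : nat) : bool :=
  [&& sub_node l k, ~~ sub_node k l
    & all (fun z => sub_node l z && sub_node z k ==> sub_node z l || sub_node k z)
        (iota 0 16)].

Lemma node_covers (k l : 'I_16) :
  covers (vinterval calP calV) (node k) (node l) <-> nat_of_ord l \in node_lower k.
Proof.
have H : all (fun k => all (fun l => cover_node k l ==
  (l \in (nth ([::], [::], [::]) node_table k).2)) (iota 0 16)) (iota 0 16).
  by vm_compute.
have /ord16/(_ l)/eqP <- := ord16 H k; split.
  move=> [_ _ [lk kl] C]; apply/and3P; split; first exact/node_sub.
    by apply/negP => /node_sub.
  apply/allP => z; rewrite mem_iota => /andP[_ z16]; apply/implyP => /andP[lz zk].
  have [||E|E] := C (node (Ordinal z16)) (Vsub_interval _).
  - exact/node_sub.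
  - exact/node_sub.
  - by apply/orP; left; apply/(node_sub (Ordinal z16) l); rewrite E.
  - by apply/orP; right; apply/(node_sub k (Ordinal z16)); rewrite E.
case/and3P => /node_sub lk /negP kl C; split; try exact: Vsub_interval.
  by split; [exact: lk|move/node_sub; exact: kl].
move=> Z /interval_node[z ->] lz zk.
have /implyP := ord16 C z.
case/(_ _)/orP; first by apply/andP; split; apply/node_sub.
  by move/node_sub => zl; left; apply/seteqP; split; [exact: zl|exact: lz].
by move/node_sub => kz; right; apply/seteqP; split; [exact: zk|exact: kz].
Qed.

Lemma card_pair (n : nat) (P : nat -> nat -> bool) :
  #|[pred e : 'I_n * 'I_n | P e.1 e.2]| =
  \sum_(0 <= i < n) \sum_(0 <= j < n) P i j.
Proof.
rewrite -sum1_card big_mkcond /= -(pair_bigA _ (fun i j : 'I_n => if P i j then 1 else 0)) /=.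
rewrite big_mkord; apply: eq_bigr => i _; rewrite big_mkord.
by apply: eq_bigr => j _; case: (P i j).
Qed.

Lemma card_ord_pred (n : nat) (P : nat -> bool) :
  #|[pred k : 'I_n | P k]| = \sum_(0 <= i < n) P i.
Proof.
rewrite -sum1_card big_mkcond /= big_mkord.
by apply: eq_bigr => i _; rewrite inE; case: (P i).
Qed.

Lemma card_covers : #|[pred e : 'I_16 * 'I_16 |
  `[< covers (vinterval calP calV) (node e.1) (node e.2) >]]| = 25.
Proof.
transitivity #|[pred e : 'I_16 * 'I_16 |
    nat_of_ord e.2 \in (nth ([::], [::], [::]) node_table e.1).2]|.
  by apply: eq_card => e; rewrite !inE (asbool_equiv_eq (node_covers _ _)) asboolb.
rewrite (card_pair 16 (fun i j => j \in (nth ([::], [::], [::]) node_table i).2)).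
by rewrite unlock; vm_compute.
Qed.

(** * Joins, meets and distributivity *)

Lemma vjoin_variety X Y : is_variety (vjoin X Y).
Proof. exact: smallest_is_variety. Qed.

Lemma vjoin_models X Y e : models (vjoin X Y) e <-> models X e /\ models Y e.
Proof.
rewrite generated_models; split=> [H|[HX HY] A [/HX|/HY]] //.
by split=> A; [move=> XA|move=> YA]; apply: H; [left|right].
Qed.

Lemma vjoin_interval X Y : vinterval calP calV X -> Y `<=` calV ->
  vinterval calP calV (vjoin X Y).
Proof.
move=> [vX [PX XV]] YV; split; first exact: vjoin_variety.
split=> [A /PX XA|]; first by apply: sub_generated; left.
by apply: generated_sub calV_variety _ => A [/XV|/YV].
Qed.

Lemma meet_interval X Y : vinterval calP calV X -> vinterval calP calV Y ->
  vinterval calP calV (X `&` Y).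
Proof.
move=> [vX [PX XV]] [vY [PY _]]; split; first exact: variety_setI.
by split=> [A PA|A [/XV]] //; split; [apply: PX|apply: PY].
Qed.

Lemma Vsub_setI E F : Vsub E `&` Vsub F = Vsub (E `|` F).
Proof.
apply/seteqP; split=> A.
  by move=> [[VA HE] [_ HF]]; split=> // _ [l [El|Fl] <-];
    [apply: HE; exists l|apply: HF; exists l].
move=> [VA H]; split; split=> // _ [l Hl <-]; apply: H; exists l => //.
  by left.
by right.
Qed.

(** A meet of nodes joins their bases, and single-premise rules derive nothing new from a union. *)
Lemma meet_models X Y l : vinterval calP calV X -> vinterval calP calV Y ->
  models (X `&` Y) (ident l) <-> models X (ident l) \/ models Y (ident l).
Proof.
move=> /interval_node[k ->] /interval_node[m ->].
rewrite Vsub_setI !Vsub_models !rule_closureP; split.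
  by case=> e [Ee|Ee] le; [left|right]; exists e.
by move=> [] [e Ee le]; exists e => //; [left|right].
Qed.

(** On labels a join acts as conjunction and a meet as disjunction, so the law becomes a
    propositional tautology. *)
Lemma interval_distributive : distributive_lattice (vinterval calP calV).
Proof.
move=> X Y Z iX iY iZ.
have YV : Y `<=` calV by case: iY => _ [].
have ZV : Z `<=` calV by case: iZ => _ [].
have XZV : X `&` Z `<=` calV by move=> A [_ /ZV].
apply: interval_eq.
- by apply: meet_interval => //; apply: vjoin_interval.
- by apply: vjoin_interval => //; apply: meet_interval.
- move=> l; rewrite vjoin_models !meet_models ?vjoin_models //; first tauto.
  exact: vjoin_interval.
Qed.

(** * The bottom node and its upper cover *)

Lemma node_calP : node (inord 15) = calP.
Proof.
rewrite /node /calP /node_basis /node_entry inordK //=; congr Vsub.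
by apply/seteqP; split=> l /=; rewrite inE => /eqP.
Qed.

Lemma node_cover_calP : node (inord 14) = Vsub [set gamma1; muD].
Proof.
rewrite /node /node_basis /node_entry inordK //=; congr Vsub.
apply/seteqP; split=> l /=; rewrite !inE; last by case=> ->; rewrite eqxx ?orbT.
by case/orP => /eqP ->; [left|right].
Qed.

Lemma covers_calP W :
  covers (subvarieties calV) W calP <->
  covers (vinterval calP calV) W (node (inord 15)).
Proof.
rewrite node_calP.
have iP : vinterval calP calV calP by exact: Vsub_interval.
split=> [[[vW WV] _ PW C]|[[vW [PW' WV]] _ PW C]].
  split=> //; first by split=> //; split=> //; case: PW.
  by move=> Z [vZ [_ ZV]] PZ ZW; apply: C.
split=> //; first by split; [apply: Vsub_variety|apply: Vsub_V].
by move=> Z [vZ ZV] PZ ZW; apply: C.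
Qed.

(** [Rsr 0 1] satisfies every label except [mu], and so does the node on the left. *)
Lemma R01_join : Vsub [set gamma1; muD] = vjoin calP (VV (Rsr 0 1)).
Proof.
have R01V : VV (Rsr 0 1) `<=` calV.
  by apply/VV_sub; [exact: calV_variety|exact: calV_R01].
apply: interval_eq; first exact: Vsub_interval.
  exact: (vjoin_interval (Vsub_interval _) R01V).
move=> l; rewrite vjoin_models VV_models R01_sat -node_cover_calP node_models.
rewrite inordK //; split=> [H|[_]]; last by case: l.
by split; [apply: calP_models|case: l H].
Qed.

(** * Position of the nodes relative to V(R_11) *)

Lemma calA_node (k : 'I_16) : calA `<=` node k <->
  all [in [:: eps; gamma1D; gamma1; kappa]] (basis_of k).
Proof.
rewrite (VV_sub _ (Vsub_variety _)); split=> [[_ H]|/allP H].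
  by apply/allP => l kl; apply/R11_sat/H; exists l.
by split=> [|_ [l kl <-]]; [apply: calV_R11|apply/R11_sat/H].
Qed.

(* In [Rsr 1 1] the two marked variables, being on the same side, take the same
   value: [ma] and [mb] are the only vertices below [mc]. *)
Definition far_marks : identity :=
  let x n := Var n in
  preceq (Mul (x 0) (x 3))
    (Add (Add (x 0) (x 4)) (Add (Add (Mul (x 0) (x 1)) (Mul (x 1) (x 2)))
      (Add (Mul (x 2) (x 3)) (Mul (x 3) (x 4))))).

Lemma R11_far_marks : sat (Rsr 1 1) far_marks.
Proof.
move=> v; rewrite /= addM_E; set s := addE 1 1.
have H : all (fun a => all (fun b => all (fun c => all (fun d => all (fun e =>
   let t := s (s a e) (s (s (mulM a b) (mulM b c)) (s (mulM c d) (mulM d e))) in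
   idxM (s (mulM a d) t) == idxM t)
   esM) esM)
   esM) esM)
   esM by vm_compute.
apply/idxM_inj/eqP.
by have /M_all/(_ (v 1))/M_all/(_ (v 2))/M_all/(_ (v 3))/M_all/(_ (v 4)) := M_all H (v 0).
Qed.

Lemma calP_not_calA : ~ calP `<=` calA.
Proof.
move=> H; have GA := H _ G_P_calP.
have /VV_models/(_ _ GA) := R11_far_marks.
(* The long path of [G_P] has both ends marked, but [v1] and [v4] are not adjacent. *)
by move=> /(_ (fun n => nth g0 [:: v1; v2; v3; v4; v5] n)); vm_compute.
Qed.

Lemma node_not_calA (k : 'I_16) : ~ node k `<=` calA.
Proof.
by move=> H; apply: calP_not_calA => A PA; apply: H; apply: (Vsub_interval _).2.1.
Qed.

Lemma incomparable_calA (k : 'I_16) : incomparable (node k) calA <->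
  ~~ all [in [:: eps; gamma1D; gamma1; kappa]] (basis_of k).
Proof.
split=> [[_ H]|/negP H]; first by apply/negP => /calA_node.
by split=> [|/calA_node]; first exact: node_not_calA.
Qed.

Lemma card_above_calA : #|[pred k : 'I_16 | `[< calA `<=` node k >]]| = 7.
Proof.
transitivity #|[pred k : 'I_16 |
    all [in [:: eps; gamma1D; gamma1; kappa]] (basis_of k)]|.
  by apply: eq_card => k; rewrite !inE (asbool_equiv_eq (calA_node _)) asboolb.
rewrite (card_ord_pred 16 (fun k => all [in [:: eps; gamma1D; gamma1; kappa]] (basis_of k))).
by rewrite unlock; vm_compute.
Qed.

Lemma card_incomparable_calA :
  #|[pred k : 'I_16 | `[< incomparable (node k) calA >]]| = 9.
Proof.
transitivity #|[pred k : 'I_16 |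
    ~~ all [in [:: eps; gamma1D; gamma1; kappa]] (basis_of k)]|.
  by apply: eq_card => k; rewrite !inE (asbool_equiv_eq (incomparable_calA _)) asboolb.
rewrite (card_ord_pred 16 (fun k => ~~ all [in [:: eps; gamma1D; gamma1; kappa]] (basis_of k))).
by rewrite unlock; vm_compute.
Qed.

Lemma node_truth_vector (k : 'I_16) : truth_vector (node k) = node_truth k.
Proof.
rewrite /truth_vector (@eq_map _ _ _ (fun l => nat_of_bool (holds k l))); last first.
  by move=> l; rewrite (asbool_equiv_eq (node_models _ _)) asboolb.
apply/eqP; move: k; apply: (@ord16 (fun k => [seq nat_of_bool (holds k l) | l <- labels]
  == (nth ([::], [::], [::]) node_table k).1.2)).
by vm_compute.
Qed.

Theorem theorem10p2 :
  (* the interval consists of exactly sixteen nodes *)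
  injective node /\
  (forall W : set algebra,
     vinterval calP calV W <-> exists k : 'I_16, W = node k) /\
  (* truth vectors *)
  (forall k : 'I_16, truth_vector (node k) = node_truth k) /\
  (* lower covers in the interval *)
  (forall k l : 'I_16,
     covers (vinterval calP calV) (node k) (node l) <->
     nat_of_ord l \in node_lower k) /\
  #|[pred e : 'I_16 * 'I_16 |
      `[< covers (vinterval calP calV) (node e.1) (node e.2) >]]| = 25 /\
  (* completeness of the rules *)
  (forall (E : set label) (f : label),
     models (Vsub E) (ident f) <-> rule_closure E f) /\
  distributive_lattice (vinterval calP calV) /\
  (* the unique upper cover of the bottom node *)
  covers (subvarieties calV) (Vsub [set gamma1; muD]) calP /\
  (forall W : set algebra,
     covers (subvarieties calV) W calP -> W = Vsub [set gamma1; muD]) /\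
  Vsub [set gamma1; muD] = vjoin calP (VV (Rsr 0 1)) /\
  (* position of the nodes relative to V(R_11) *)
  #|[pred k : 'I_16 | `[< calA `<=` node k >]]| = 7 /\
  (forall k : 'I_16, calA `<=` node k \/ incomparable (node k) calA) /\
  #|[pred k : 'I_16 | `[< incomparable (node k) calA >]]| = 9.
Proof.
split; first exact: node_inj.
split.
  by move=> W; split=> [/interval_node //|[k ->]]; apply: Vsub_interval.
split; first exact: node_truth_vector.
split; first exact: node_covers.
split; first exact: card_covers.
split; first exact: Vsub_models.
split; first exact: interval_distributive.
split.
  apply/covers_calP; rewrite -node_cover_calP.
  by apply/node_covers; rewrite /node_lower /node_entry !inordK.
split.
  move=> W /covers_calP C; have [k E] : exists k, W = node k.
    by apply: interval_node; case: C.
  move: C; rewrite E => /node_covers.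
  rewrite /node_lower /node_entry inordK // -node_cover_calP => k15.
  congr node; apply/val_inj; rewrite /= inordK //; apply/eqP; move: k15.
  apply/implyP; move: (k); apply: (@ord16 (fun k =>
    (15 \in (nth ([::], [::], [::]) node_table k).2) ==> (k == 14))).
  by vm_compute.
split; first exact: R01_join.
split; first exact: card_above_calA.
split; last exact: card_incomparable_calA.
move=> k; case: (boolP (all [in [:: eps; gamma1D; gamma1; kappa]] (basis_of k))).
  by move=> /calA_node; left.
by move=> /incomparable_calA; right.
Qed.
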